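(* Let $k$ be a field. (a) For any infinite set $X$, the functor $-[[X]]\colon\mathsf{Top}^{\mathsf{sc}}_{\mathbb Z}\to\mathsf{Top}^{\mathsf{sc}}_{\mathbb Z}$ is not exact with respect to the maximal exact structure on $\mathsf{Top}^{\mathsf{sc}}_{\mathbb Z}$. (b) For any infinite set $X$, the functor $-[[X]]\colon\mathsf{Top}^{\mathsf{sc}}_k\to\mathsf{Top}^{\mathsf{sc}}_k$ is not exact with respect to the maximal exact structure on $\mathsf{Top}^{\mathsf{sc}}_k$.
   Context: All topological abelian groups have linear topology: open subgroups form a base of neighborhoods of zero. All topological $k$-vector spaces ($k$ a fixed field with the discrete topology) have linear topology: open vector subspaces form a base of neighborhoods of zero. The completion of $A$ is $A^{\wedge}=\varprojlim_{U\subset A}A/U$ over the open subgroups (resp. subspaces) $U$, topologized so that the kernels of the projections $A^{\wedge}\to A/U$ form a base of neighborhoods of zero. $A$ is separated (resp. complete) if $A\to A^{\wedge}$ is injective (resp. surjective). $\mathsf{Top}^{\mathsf{sc}}_{\mathbb Z}$ (resp. $\mathsf{Top}^{\mathsf{sc}}_k$) is the additive category of complete, separated topological abelian groups (resp. $k$-vector spaces) and continuous homomorphisms (resp. continuous $k$-linear maps). For $\mathfrak A$ in $\mathsf{Top}^{\mathsf{sc}}_{\mathbb Z}$ or $\mathsf{Top}^{\mathsf{sc}}_k$ and a set $X$, put $\mathfrak A[[X]]=\varprojlim_{\mathfrak U\subset\mathfrak A}(\mathfrak A/\mathfrak U)[X]$, where $\mathfrak U$ ranges over the open subgroups (resp.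 subspaces) and $B[X]=B^{(X)}$ is the direct sum of $X$ copies of $B$; equivalently, $\mathfrak A[[X]]$ is the group of infinite formal linear combinations $\sum_{x\in X}a_xx$ with families $(a_x\in\mathfrak A)_{x\in X}$ converging to zero (for each open $\mathfrak U$, the set $\{x:a_x\notin\mathfrak U\}$ is finite). It carries the topology of projective limit of the discrete groups $(\mathfrak A/\mathfrak U)[X]$, making it complete and separated. A morphism $g\colon\mathfrak A\to\mathfrak B$ induces $g[[X]]\colon\sum a_xx\mapsto\sum g(a_x)x$. The maximal exact structure on an additive category is its largest exact category structure in Quillen's sense (it contains every other exact structure). It exists for $\mathsf{Top}^{\mathsf{sc}}_{\mathbb Z}$ and $\mathsf{Top}^{\mathsf{sc}}_k$; its short exact sequences are exactly the sequences $0\to\mathfrak K\overset{i}\to\mathfrak A\overset{p}\to\mathfrak C\to0$ in which $i$ is a kernel of $p$, $p$ is a cokernel of $i$, and $p$ is a surjective open map. An additive functor is exact if it takes short exact sequences to short exact sequences. *)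

(* Defs.v *)
From HB Require Import structures.
From mathcomp Require Import all_boot all_algebra all_classical.
From mathcomp Require Import topology tvs.

Set Implicit Arguments.
Unset Strict Implicit.
Unset Printing Implicit Defensive.

Import GRing.Theory.
Local Open Scope classical_set_scope.
Local Open Scope ring_scope.

Reserved Notation "g \oc f" (at level 40, left associativity).

Record preadditive_category := PreadditiveCategory {
  ob :> Type;
  hom : ob -> ob -> zmodType;
  idm : forall A, hom A A;
  comp : forall A B C, hom B C -> hom A B -> hom A C;
  compA : forall A B C D (h : hom C D) (g : hom B C) (f : hom A B),
    comp h (comp g f) = comp (comp h g) f;
  comp1m : forall A B (f : hom A B), comp (idm B) f = f;
  compm1 : forall A B (f : hom A B), comp f (idm A) = f;
  compDl : forall A B C (g g' : hom B C) (f : hom A B),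
    comp (g + g') f = comp g f + comp g' f;
  compDr : forall A B C (g : hom B C) (f f' : hom A B),
    comp g (f + f') = comp g f + comp g f' }.

Arguments idm {p} A.
Arguments comp {p A B C} g f.
Notation "g \oc f" := (comp g f).

Definition is_zero_object (C : preadditive_category) (Z : C) : Prop :=
  (forall A (f : hom A Z), f = 0) /\ (forall A (f : hom Z A), f = 0).

Definition is_biproduct (C : preadditive_category) (A B P : C)
    (i1 : hom A P) (i2 : hom B P) (p1 : hom P A) (p2 : hom P B) : Prop :=
  [/\ p1 \oc i1 = idm A, p2 \oc i2 = idm B, p1 \oc i2 = 0, p2 \oc i1 = 0 &
      i1 \oc p1 + i2 \oc p2 = idm P].

Record additive_category := AdditiveCategory {
  additive_base :> preadditive_category;
  has_zero_object : exists Z : additive_base, is_zero_object Z;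
  has_biproducts : forall A B : additive_base,
    exists P i1 i2 p1 p2, @is_biproduct additive_base A B P i1 i2 p1 p2 }.

Section ExactStructures.
Variable C : additive_category.
Implicit Types A B : C.

Definition is_iso A B (f : hom A B) : Prop :=
  exists g : hom B A, g \oc f = idm A /\ f \oc g = idm B.

Definition is_kernel K A B (i : hom K A) (p : hom A B) : Prop :=
  p \oc i = 0 /\
  forall T (f : hom T A), p \oc f = 0 -> exists! g : hom T K, i \oc g = f.

Definition is_cokernel K A B (p : hom A B) (i : hom K A) : Prop :=
  p \oc i = 0 /\
  forall T (f : hom A T), f \oc i = 0 -> exists! g : hom B T, g \oc p = f.

(*   A --f--> B
     |g       |g'
     v        v
     A' -f'-> B'   *)
Definition is_pushout A B A' B' (f : hom A B) (g : hom A A')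
    (f' : hom A' B') (g' : hom B B') : Prop :=
  g' \oc f = f' \oc g /\
  forall T (u : hom B T) (v : hom A' T), u \oc f = v \oc g ->
    exists! w : hom B' T, w \oc g' = u /\ w \oc f' = v.

Definition is_pullback A B A' B' (f : hom A B) (g : hom A A')
    (f' : hom A' B') (g' : hom B B') : Prop :=
  g' \oc f = f' \oc g /\
  forall T (u : hom T B) (v : hom T A'), g' \oc u = f' \oc v ->
    exists! w : hom T A, f \oc w = u /\ g \oc w = v.

Record short_seq := ShortSeq {
  seq_sub : C; seq_mid : C; seq_quo : C;
  seq_inj : hom seq_sub seq_mid;
  seq_prj : hom seq_mid seq_quo }.

Definition short_seq_iso (S T : short_seq) : Prop :=
  exists (a : hom (seq_sub S) (seq_sub T)) (b : hom (seq_mid S) (seq_mid T))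
         (c : hom (seq_quo S) (seq_quo T)),
  [/\ is_iso a, is_iso b, is_iso c,
      b \oc seq_inj S = seq_inj T \oc a &
      c \oc seq_prj S = seq_prj T \oc b].

Definition admissible_mono (E : short_seq -> Prop) A B (i : hom A B) : Prop :=
  exists Q (p : hom B Q), E (ShortSeq i p).

Definition admissible_epi (E : short_seq -> Prop) A B (p : hom A B) : Prop :=
  exists K (i : hom K A), E (ShortSeq i p).

(* Quillen's axioms, as listed in T. Buehler, Exact categories, section 2.
   Conflations are kernel-cokernel pairs; E0, E1, E2 and their duals follow. *)
Record exact_structure (E : short_seq -> Prop) : Prop := ExactStructure {
  exact_ker_coker : forall S, E S ->
    is_kernel (seq_inj S) (seq_prj S) /\ is_cokernel (seq_prj S) (seq_inj S);
  exact_iso : forall S T, E S -> short_seq_iso S T -> E T;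
  exact_id_mono : forall A, admissible_mono E (idm A);
  exact_id_epi : forall A, admissible_epi E (idm A);
  exact_comp_mono : forall A B D (f : hom A B) (g : hom B D),
    admissible_mono E f -> admissible_mono E g -> admissible_mono E (g \oc f);
  exact_comp_epi : forall A B D (f : hom A B) (g : hom B D),
    admissible_epi E f -> admissible_epi E g -> admissible_epi E (g \oc f);
  exact_pushout : forall A B A' (f : hom A B) (g : hom A A'),
    admissible_mono E f ->
    exists B' (f' : hom A' B') (g' : hom B B'),
      is_pushout f g f' g' /\ admissible_mono E f';
  exact_pullback : forall B A' B' (f' : hom A' B') (g' : hom B B'),
    admissible_epi E f' ->
    exists A (f : hom A B) (g : hom A A'),
      is_pullback f g f' g' /\ admissible_epi E f }.

Definition maximal_exact_structure (E : short_seq -> Prop) : Prop :=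
  exact_structure E /\
  forall E', exact_structure E' -> forall S, E' S -> E S.

End ExactStructures.

Record additive_functor (C D : additive_category) := AdditiveFunctor {
  fob :> C -> D;
  fhom : forall A B : C, hom A B -> hom (fob A) (fob B);
  fhom1 : forall A : C, fhom (idm A) = idm (fob A);
  fhomM : forall (A B E : C) (g : hom B E) (f : hom A B),
    fhom (g \oc f) = fhom g \oc fhom f;
  fhomD : forall (A B : C) (f g : hom A B), fhom (f + g) = fhom f + fhom g }.

Definition functor_seq (C D : additive_category) (F : additive_functor C D)
  (S : short_seq C) : short_seq D :=
  ShortSeq (fhom F (seq_inj S)) (fhom F (seq_prj S)).

Definition exact_functor (C D : additive_category)
    (E : short_seq C -> Prop) (E' : short_seq D -> Prop)
    (F : additive_functor C D) : Prop :=
  forall S, E S -> E' (functor_seq F S).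

Definition subgroup (A : zmodType) : set (set A) :=
  [set U | U 0 /\ forall x y, U x -> U y -> U (x - y)].

Definition subspace (k : fieldType) (V : lmodType k) : set (set V) :=
  [set U | U 0 /\ forall (a : k) x y, U x -> U y -> U (a *: x + y)].

Lemma subspace_subgroup (k : fieldType) (V : lmodType k) (U : set V) :
  subspace U -> subgroup U.
Proof.
move=> [U0 UZ]; split=> // x y Ux Uy.
by have := UZ (-1) _ _ Uy Ux; rewrite scaleN1r addrC.
Qed.

(* [sub] is the class of all subgroups, respectively of all subspaces. *)
Section LinearTopology.
Variables (A : topologicalZmodType) (sub : set (set A)).

Definition open_sub (U : set A) : Prop := sub U /\ open U.

Definition linear_topology : Prop :=
  forall N : set A, nbhs (0 : A) N -> exists2 U, open_sub U & U `<=` N.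

Definition coset (U : set A) (a : A) : set A := [set x | U (x - a)].

(* The elements of the limit of the A/U: a choice, for every open U, of a coset
   c U, the projection A/V -> A/U sending a coset of V to the coset of U
   containing it. *)
Definition compatible_cosets (c : set A -> set A) : Prop :=
  (forall U, open_sub U -> exists a, c U = coset U a) /\
  (forall U V, open_sub U -> open_sub V -> V `<=` U -> c V `<=` c U).

Definition separated_topology : Prop :=
  forall a b, (forall U, open_sub U -> coset U a = coset U b) -> a = b.

Definition complete_topology : Prop :=
  forall c, compatible_cosets c ->
    exists a, forall U, open_sub U -> c U = coset U a.

Definition sc_topology : Prop :=
  [/\ linear_topology, separated_topology & complete_topology].

End LinearTopology.

Lemma cosetE (A : topologicalZmodType) (U : set A) (a b : A) :
  subgroup U -> coset U a = coset U b <-> U (a - b).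
Proof.
move=> [U0 UB]; split=> [ab|Uab].
  suff : coset U b a by [].
  by rewrite -ab /coset /= subrr.
have Uba : U (b - a) by rewrite -opprB -[- _]add0r; exact: UB.
apply/seteqP; split=> x /= Ux.
  by have := UB _ _ Ux Uba; rewrite opprB addrA subrK.
by have := UB _ _ Ux Uab; rewrite opprB addrA subrK.
Qed.

Lemma coset_refl (A : topologicalZmodType) (U : set A) (a : A) :
  subgroup U -> coset U a a.
Proof. by move=> [U0 _]; rewrite /coset /= subrr. Qed.

Lemma complete_from_base (A : topologicalZmodType) (sub : set (set A)) :
  (forall U, sub U -> subgroup U) ->
  (forall c, compatible_cosets sub c -> exists a, forall W, open_sub sub W ->
    exists U, [/\ open_sub sub U, U `<=` W & c U a]) ->
  complete_topology sub.
Proof.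
move=> subG base c cc; have [a ca] := base c cc; exists a => W oW.
have [U [oU UW cUa]] := ca W oW.
have [b cW] := cc.1 W oW; rewrite cW; apply/(cosetE _ _ (subG _ oW.1)).
have : c W a := cc.2 _ _ oW oU UW _ cUa.
rewrite cW /coset /= => Wab; have [W0 WB] := subG _ oW.1.
by rewrite -opprB -[- _]add0r; exact: WB.
Qed.

(* The library's topologicalLmodType only covers scalars in a numDomainType,
   topologized by their norm; here k is an arbitrary field, with the discrete
   topology. *)
Record topologicalVect (k : fieldType) := TopologicalVect {
  tv_group : topologicalZmodType;
  tv_lmodule : GRing.Zmodule_isLmodule k tv_group;
  tv_scale_continuous : continuous (fun z : discrete_topology k * tv_group =>
    GRing.Zmodule_isLmodule.scale tv_lmodule (z.1 : k) z.2) }.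

Definition tv_sort (k : fieldType) (V : topologicalVect k) : Type :=
  tv_group V.
Coercion tv_sort : topologicalVect >-> Sortclass.

HB.instance Definition _ (k : fieldType) (V : topologicalVect k) :=
  TopologicalZmodule.copy (tv_sort V) (tv_group V).
HB.instance Definition _ (k : fieldType) (V : topologicalVect k) :
  GRing.Zmodule_isLmodule k (tv_sort V) := tv_lmodule V.

Lemma vscale_continuous (k : fieldType) (V : topologicalVect k) :
  continuous (fun z : discrete_topology k * V => (z.1 : k) *: z.2).
Proof. exact: tv_scale_continuous. Qed.

Lemma continuous_pair (T U V : topologicalType) (f : T -> U) (g : T -> V) :
  continuous f -> continuous g -> continuous (fun x => (f x, g x)).
Proof. by move=> fc gc x; apply: cvg_pair; [exact: fc|exact: gc]. Qed.

Lemma continuous_sub (T : topologicalType) (A : topologicalZmodType)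
  (f g : T -> A) : continuous f -> continuous g -> continuous (f - g).
Proof.
move=> fc gc x.
apply: (@continuous_comp _ _ _ (fun x => (f x, g x)) (fun x => x.1 - x.2)).
  exact: continuous_pair.
exact: sub_continuous.
Qed.

Lemma continuous_vscale (k : fieldType) (T : topologicalType)
    (V : topologicalVect k) (f : T -> discrete_topology k) (g : T -> V) :
  continuous f -> continuous g -> continuous (fun x => (f x : k) *: g x).
Proof.
move=> fc gc x.
apply: (@continuous_comp _ _ _ (fun x => (f x, g x))
  (fun z : discrete_topology k * V => (z.1 : k) *: z.2)).
  exact: continuous_pair.
exact: vscale_continuous.
Qed.

Definition trivial_group : Type := discrete_topology unit.

HB.instance Definition _ := DiscreteTopology.on trivial_group.

Section TrivialGroup.
Let op (x y : trivial_group) : trivial_group := tt.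
Let opp (x : trivial_group) : trivial_group := tt.
Let opA : associative op. Proof. by []. Qed.
Let opC : commutative op. Proof. by []. Qed.
Let op0 : left_id (tt : trivial_group) op. Proof. by case. Qed.
Let opN : left_inverse (tt : trivial_group) opp op. Proof. by []. Qed.
HB.instance Definition _ :=
  GRing.isZmodule.Build trivial_group opA opC op0 opN.

Lemma trivial_groupE (x y : trivial_group) : x = y.
Proof. by case: x y => -[]. Qed.

Let sub_continuous :
  continuous (fun x : trivial_group * trivial_group => x.1 - x.2).
Proof.
move=> x N N0; rewrite /nbhs /=; apply: filterS filterT => y _ /=.
by move/nbhs_singleton: N0; rewrite (trivial_groupE (_ - _) (x.1 - x.2)).
Qed.
HB.instance Definition _ :=
  PreTopologicalNmodule_isTopologicalZmodule.Build trivial_group sub_continuous.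

Section Scale.
Variable k : fieldType.
Let scale (a : k) (x : trivial_group) : trivial_group := tt.
Let scaleA a b v : scale a (scale b v) = scale (a * b) v. Proof. by []. Qed.
Let scale1 : left_id 1 scale. Proof. by case. Qed.
Let scaleDr : right_distributive scale +%R. Proof. by []. Qed.
Let scaleDl v : {morph scale^~ v : a b / a + b}. Proof. by []. Qed.
HB.instance Definition _ :=
  GRing.Zmodule_isLmodule.Build k trivial_group scaleA scale1 scaleDr scaleDl.
End Scale.
End TrivialGroup.

(* The library has a topological group structure on A * B only for locally
   convex spaces over a numDomainType. *)
Definition prod_group (A B : Type) : Type := (A * B)%type.

HB.instance Definition _ (A B : topologicalType) :=
  Topological.on (prod_group A B).
HB.instance Definition _ (A B : zmodType) := GRing.Zmodule.on (prod_group A B).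
HB.instance Definition _ (R : pzRingType) (A B : lmodType R) :=
  GRing.Lmodule.on (prod_group A B).

Section ProductGroup.
Variables A B : topologicalZmodType.

Let sub_continuous :
  continuous (fun x : prod_group A B * prod_group A B => x.1 - x.2).
Proof.
have := @continuous_pair (prod_group A B * prod_group A B)%type A B
  (fun x => x.1.1 - x.2.1) (fun x => x.1.2 - x.2.2).
apply.
  apply: (continuous_sub (f := fun x : (A * B) * (A * B) => x.1.1)
    (g := fun x : (A * B) * (A * B) => x.2.1)) => x.
    by apply: cvg_comp; exact: cvg_fst.
  by apply: cvg_comp; [exact: cvg_snd|exact: cvg_fst].
apply: (continuous_sub (f := fun x : (A * B) * (A * B) => x.1.2)
  (g := fun x : (A * B) * (A * B) => x.2.2)) => x.
  by apply: cvg_comp; [exact: cvg_fst|exact: cvg_snd].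
by apply: cvg_comp; exact: cvg_snd.
Qed.
HB.instance Definition _ :=
  PreTopologicalNmodule_isTopologicalZmodule.Build (prod_group A B)
    sub_continuous.
End ProductGroup.

Section ProductTopology.
Variables (A B : topologicalZmodType).
Variables (subA : set (set A)) (subB : set (set B)).
Variable sub : set (set (prod_group A B)).
Hypotheses (subA_group : forall U, subA U -> subgroup U)
  (subB_group : forall U, subB U -> subgroup U)
  (sub_group : forall W, sub W -> subgroup W)
  (subAT : subA setT) (subBT : subB setT)
  (subX : forall U V, subA U -> subB V -> sub (U `*` V)).
Hypotheses (scA : sc_topology subA) (scB : sc_topology subB).

Lemma open_sub_setX U V :
  open_sub subA U -> open_sub subB V -> open_sub sub (U `*` V).
Proof.
move=> [sU oU] [sV oV]; split; first exact: subX.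
rewrite openE => -[a b] /= [Ua Vb]; exists (U, V) => //=; split => /=;
  exact: open_nbhs_nbhs.
Qed.

Lemma prod_group_sc : sc_topology sub.
Proof.
have [linA sepA comA] := scA; have [linB sepB comB] := scB.
have oAT : open_sub subA setT by split => //; exact: openT.
have oBT : open_sub subB setT by split => //; exact: openT.
have lin : linear_topology sub.
  move=> N [[P Q] /= [P0 Q0] PQN].
  have [U oU UP] := linA _ P0; have [V oV VQ] := linB _ Q0.
  exists (U `*` V); first exact: open_sub_setX.
  by move=> [x y] /= [Ux Vy]; apply: PQN; split; [exact: UP|exact: VQ].
split=> //.
  move=> [a b] [a' b'] eqab; congr pair.
    apply: sepA => U oU; apply/(cosetE _ _ (subA_group oU.1)).
    have oW := open_sub_setX oU oBT.
    by have /(cosetE _ _ (sub_group oW.1))[] := eqab _ oW.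
  apply: sepB => V oV; apply/(cosetE _ _ (subB_group oV.1)).
  have oW := open_sub_setX oAT oV.
  by have /(cosetE _ _ (sub_group oW.1))[] := eqab _ oW.
apply: complete_from_base => // c [cE cS].
have [a ca] : exists a, forall U, open_sub subA U ->
    [set x | exists y, c (U `*` setT) (x, y)] = coset U a.
  apply: comA; split=> [U oU|U V oU oV VU x [y cxy]].
    have [[a b] ->] := cE _ (open_sub_setX oU oBT); exists a.
    by apply/seteqP; split=> [x [y []]//|x Ux]; exists 0.
  exists y; move: cxy; apply: cS; [exact: open_sub_setX|exact: open_sub_setX|].
  by move=> [u v] [/VU].
have [b cb] : exists b, forall V, open_sub subB V ->
    [set y | exists x, c (setT `*` V) (x, y)] = coset V b.
  apply: comB; split=> [V oV|U V oU oV VU y [x cxy]].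
    have [[a' b] ->] := cE _ (open_sub_setX oAT oV); exists b.
    by apply/seteqP; split=> [y [x []]//|y Vy]; exists 0.
  exists x; move: cxy; apply: cS; [exact: open_sub_setX|exact: open_sub_setX|].
  by move=> [u v] [? /VU].
exists (a, b) => W oW.
have [U oU [V oV UVW]] : exists2 U, open_sub subA U &
    exists2 V, open_sub subB V & U `*` V `<=` W.
  have [[P Q] /= [P0 Q0] PQW] : nbhs (0 : prod_group A B) W.
    by apply: open_nbhs_nbhs; split; [exact: oW.2|have [] := sub_group oW.1].
  have [U oU UP] := linA _ P0; have [V oV VQ] := linB _ Q0.
  exists U => //; exists V => // -[x y] /= [Ux Vy].
  by apply: PQW; split; [exact: UP|exact: VQ].
have oUV := open_sub_setX oU oV.
exists (U `*` V); split=> //.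
have [[p q] cUV] := cE _ oUV; rewrite cUV.
have cpq : c (U `*` V) (p, q).
  by rewrite cUV; exact: (coset_refl _ (sub_group oUV.1)).
suff : @coset (prod_group A B) (U `*` V) (a, b) =
       @coset (prod_group A B) (U `*` V) (p, q).
  by move=> <-; exact: (coset_refl _ (sub_group oUV.1)).
apply/esym/(cosetE _ _ (sub_group oUV.1)); split => /=.
  have : [set x | exists y, c (U `*` setT) (x, y)] p.
    exists q; move: cpq; apply: cS => //; [exact: open_sub_setX|].
    by move=> [u v] [].
  by rewrite ca.
have : [set y | exists x, c (setT `*` V) (x, y)] q.
  exists p; move: cpq; apply: cS => //; [exact: open_sub_setX|].
  by move=> [u v] [].
by rewrite cb.
Qed.

End ProductTopology.

Lemma trivial_group_sc (sub : set (set trivial_group)) :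
  (forall U, sub U -> subgroup U) -> sub setT -> sc_topology sub.
Proof.
move=> subG subT; split.
- move=> N /nbhs_singleton N0; exists setT; first by split => //; exact: openT.
  by move=> x _; rewrite (trivial_groupE x 0).
- by move=> a b _; exact: trivial_groupE.
- move=> c [cE _]; exists 0 => U oU; have [a ->] := cE _ oU.
  by rewrite (trivial_groupE a 0).
Qed.

(* T must carry both a canonical lmodType and a canonical topologicalZmodType
   structure, with the same addition. *)
Notation topologicalVect_of k T cont :=
  (@TopologicalVect k T
    (GRing.Zmodule_isLmodule.Build k T (@scalerA k T) (@scale1r k T)
      (@scalerDr k T) (@scalerDl k T)) cont).

Section TrivialVect.
Variable k : fieldType.

Let vscale_continuous : continuous
  (fun z : discrete_topology k * trivial_group => (z.1 : k) *: z.2).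
Proof.
move=> x N N0; rewrite /nbhs /=; apply: filterS filterT => y _ /=.
by move/nbhs_singleton: N0; rewrite (trivial_groupE (_ *: _) ((x.1 : k) *: x.2)).
Qed.

Definition trivial_vect : topologicalVect k :=
  topologicalVect_of k trivial_group vscale_continuous.
End TrivialVect.

Section ProductVect.
Variables (k : fieldType) (A B : topologicalVect k).

Let vscale_continuous :
  continuous (fun z : discrete_topology k * prod_group A B => (z.1 : k) *: z.2).
Proof.
have := @continuous_pair (discrete_topology k * prod_group A B)%type A B
  (fun x => (x.1 : k) *: x.2.1) (fun x => (x.1 : k) *: x.2.2).
apply.
  apply: (continuous_vscale (f := fun x : discrete_topology k * prod_group A B => x.1)
    (g := fun x => x.2.1)) => x; first exact: cvg_fst.
  by apply: cvg_comp; [exact: cvg_snd|exact: cvg_fst].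
apply: (continuous_vscale (f := fun x : discrete_topology k * prod_group A B => x.1)
  (g := fun x => x.2.2)) => x; first exact: cvg_fst.
by apply: cvg_comp; exact: cvg_snd.
Qed.

Definition prod_vect : topologicalVect k :=
  topologicalVect_of k (prod_group A B) vscale_continuous.
End ProductVect.

(* A[[X]], as the group of formal linear combinations of the elements of X whose
   family of coefficients converges to zero. Convergence and topology are given
   by neighborhoods of zero, so that the definition serves groups and vector
   spaces alike; converges_to_zeroP and nbhs_formal_sumsP give the form with open
   subgroups (subspaces), formal_sums_limit the identification with the
   projective limit of the (A/U)[X]. *)
Section FormalSums.
Variables (A : topologicalZmodType) (X : Type).

Definition converges_to_zero : set (X -> A) :=
  [set f | forall N : set A, nbhs (0 : A) N -> finite_set [set x | ~ N (f x)]].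

Definition converging_family : {pred X -> A} := mem converges_to_zero.

Let converging_zmod_closed : zmod_closed converging_family.
Proof.
split=> [|f g]; rewrite !inE /converges_to_zero /=.
  move=> N N0; apply: (@sub_finite_set _ _ set0) => // x /=.
  by move/nbhs_singleton: N0 => N0 /(_ N0).
move=> f0 g0 N N0.
have /= := @sub_continuous A (0, 0) N; rewrite subr0 => /(_ N0).
move=> [[P Q] /= [P0 Q0] PQN].
apply: (@sub_finite_set _ _ ([set x | ~ P (f x)] `|` [set x | ~ Q (g x)])).
  move=> x /= nN; apply: contrapT => /not_orP[/contrapT Pf /contrapT Qg].
  by apply: nN; apply: (PQN (f x, g x)).
by rewrite finite_setU; split; [exact: f0|exact: g0].
Qed.

HB.instance Definition _ :=
  GRing.isZmodClosed.Build (X -> A) converging_family converging_zmod_closed.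

Record formal_sums := FormalSum {
  coef :> X -> A;
  coefP : coef \in converging_family }.

HB.instance Definition _ := [isSub for coef].
HB.instance Definition _ := [Choice of formal_sums by <:].
HB.instance Definition _ := [SubChoice_isSubZmodule of formal_sums by <:].

Lemma coef0 x : (0 : formal_sums) x = 0. Proof. by []. Qed.
Lemma coefD (f g : formal_sums) x : (f + g) x = f x + g x. Proof. by []. Qed.
Lemma coefB (f g : formal_sums) x : (f - g) x = f x - g x. Proof. by []. Qed.
Lemma formal_sumsP (f g : formal_sums) : (forall x, f x = g x) -> f = g.
Proof. by move=> fg; apply: val_inj; apply: funext. Qed.

Definition coefs_in (U : set A) : set formal_sums := [set f | forall x, U (f x)].

Definition formal_sums_nbhs (f : formal_sums) : set_system formal_sums :=
  filter_from (nbhs (0 : A)) (fun N => [set g | coefs_in N (g - f)]).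

HB.instance Definition _ := hasNbhs.Build formal_sums formal_sums_nbhs.

Let nbhs_filter (f : formal_sums) : ProperFilter (nbhs f).
Proof.
apply: filter_from_proper => [|N N0]; last first.
  exists f; rewrite /= subrr => x /=; exact: nbhs_singleton.
apply: filter_from_filter; first by exists setT; exact: filterT.
move=> M N M0 N0; exists (M `&` N); first exact: filterI.
by move=> g /= gMN; split=> x; case: (gMN x).
Qed.

Let nbhs_singleton' (f : formal_sums) (P : set formal_sums) :
  nbhs f P -> P f.
Proof.
by case=> N N0; apply; rewrite /= subrr => x; exact: nbhs_singleton.
Qed.

Let nbhs_nbhs (f : formal_sums) (P : set formal_sums) :
  nbhs f P -> nbhs f (nbhs^~ P).
Proof.
case=> N N0 NP.
have /= := @add_continuous A (0, 0) N; rewrite addr0 => /(_ N0).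
move=> [[M M'] /= [M0 M'0] MN].
exists (M `&` M'); first exact: filterI.
move=> g /= gM; exists (M `&` M'); first exact: filterI.
move=> h /= hM; apply: NP => x.
have -> : h - f = (h - g) + (g - f) by rewrite addrA subrK.
by apply: (MN (_, _)); split=> /=; [case: (hM x)|case: (gM x)].
Qed.

HB.instance Definition _ := Nbhs_isNbhsTopological.Build formal_sums
  nbhs_filter nbhs_singleton' nbhs_nbhs.

Let sub_continuous : continuous (fun x : formal_sums * formal_sums => x.1 - x.2).
Proof.
move=> [f g] P [N N0 NP] /=.
have /= := @sub_continuous A (0, 0) N; rewrite subr0 => /(_ N0).
move=> [[M M'] /= [M0 M'0] MN].
exists ([set h | coefs_in M (h - f)], [set h | coefs_in M' (h - g)]).
  by split; [exists M|exists M'].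
move=> [h h'] /= [hM hM']; apply: NP => x.
have -> : h - h' - (f - g) = (h - f) - (h' - g).
  by rewrite !opprB addrACA [RHS]addrACA [- h' + _]addrC.
by apply: (MN (_, _)); split; [exact: hM|exact: hM'].
Qed.

HB.instance Definition _ :=
  PreTopologicalNmodule_isTopologicalZmodule.Build formal_sums sub_continuous.

End FormalSums.

Section FormalSumsTopology.
Variables (A : topologicalZmodType) (X : Type).
Local Notation AX := (formal_sums A X).
Variables (sub : set (set A)) (subX : set (set AX)).
Hypotheses (sub_group : forall U, sub U -> subgroup U)
  (subX_group : forall W, subX W -> subgroup W)
  (sub_coefs_in : forall U, sub U -> subX (@coefs_in A X U)).

Lemma open_sub_coefs_in U :
  open_sub sub U -> open_sub subX (@coefs_in A X U).
Proof.
move=> [sU oU]; split; first exact: sub_coefs_in.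
have [U0 UB] := sub_group sU.
rewrite openE => f Uf; exists U; first exact: open_nbhs_nbhs.
move=> g /= Ug x.
have -> : g x = (g - f) x - (0 - f x) by rewrite sub0r opprK coefB subrK.
by apply: (UB); [exact: Ug|apply: UB => //; exact: Uf].
Qed.

Hypothesis sc : sc_topology sub.

Lemma converges_to_zeroP (f : X -> A) : converges_to_zero f <->
  forall U, open_sub sub U -> finite_set [set x | ~ U (f x)].
Proof.
split=> f0 => [U oU|N N0].
  apply: f0; apply: open_nbhs_nbhs; split; first exact: oU.2.
  by have [] := sub_group oU.1.
have [lin _ _] := sc; have [U oU UN] := lin _ N0.
by apply: sub_finite_set (f0 _ oU) => x /= nN Ux; apply: nN; exact: UN.
Qed.

Lemma nbhs_formal_sumsP (f : AX) (P : set AX) : nbhs f P <->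
  exists2 U, open_sub sub U & forall g, coefs_in U (g - f) -> P g.
Proof.
split=> [[N N0 NP]|[U oU UP]].
  have [lin _ _] := sc; have [U oU UN] := lin _ N0.
  by exists U => // g Ug; apply: NP => x; apply: UN; exact: Ug.
exists U => //; apply: open_nbhs_nbhs; split; first exact: oU.2.
by have [] := sub_group oU.1.
Qed.

(* An element of (A/U)[X] is a finitely supported map from X to the cosets of
   U. *)
Lemma formal_sums_limit (c : set A -> X -> set A) :
  (forall U, open_sub sub U -> forall x, exists a, c U x = coset U a) ->
  (forall U, open_sub sub U -> finite_set [set x | c U x <> U]) ->
  (forall U V, open_sub sub U -> open_sub sub V -> V `<=` U ->
    forall x, c V x `<=` c U x) ->
  exists! f : AX, forall U, open_sub sub U -> forall x, c U x = coset U (f x).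
Proof.
move=> cE cfin cS; have [lin sep com] := sc.
have /choice[f fE] : forall x, exists a, forall U, open_sub sub U ->
    c U x = coset U a.
  move=> x; apply: (com (c ^~ x)); split=> [U oU|U V oU oV VU].
    exact: cE.
  exact: cS.
have f0 : f \in @converging_family A X.
  rewrite inE; apply/converges_to_zeroP => U oU.
  apply: sub_finite_set (cfin _ oU) => x /= nUfx.
  rewrite (fE _ _ oU) => eqU; apply: nUfx; rewrite -eqU.
  exact: (coset_refl _ (sub_group oU.1)).
exists (FormalSum f0); split=> [U oU x|g gE]; first exact: fE.
apply: formal_sumsP => x; apply: sep => U oU.
by rewrite -gE // fE.
Qed.

Lemma formal_sums_sc : sc_topology subX.
Proof.
have [lin sep com] := sc; split.
- move=> P /nbhs_formal_sumsP[U oU UP].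
  exists (@coefs_in A X U); first exact: open_sub_coefs_in.
  by move=> g Ug; apply: UP; rewrite subr0.
- move=> f g eqfg; apply: formal_sumsP => x; apply: sep => U oU.
  apply/(cosetE _ _ (sub_group oU.1)).
  have oW := open_sub_coefs_in oU.
  by have /(cosetE _ _ (subX_group oW.1))/(_ x) := eqfg _ oW.
apply: complete_from_base => // c [cE cS].
have oW U : open_sub sub U -> open_sub subX (@coefs_in A X U).
  exact: open_sub_coefs_in.
have [f [fE _]] : exists! f : AX, forall U, open_sub sub U -> forall x,
    [set a | exists2 g : AX, c (@coefs_in A X U) g & U (a - g x)] =
    coset U (f x).
  apply: formal_sums_limit => [U oU x|U oU|U V oU oV VU x a].
  - have [g cg] := cE _ (oW _ oU); exists (g x).
    have [U0 UB] := sub_group oU.1.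
    rewrite cg; apply/seteqP; split=> [a [h Uh Ua]|a Ua]; last first.
      by exists g => //; exact: (coset_refl _ (subX_group (oW _ oU).1)).
    have Uhg : U (h x - g x) by exact: Uh.
    have Ugh : U (g x - h x) by rewrite -opprB -[- _]add0r; exact: UB.
    by have := UB _ _ Ua Ugh; rewrite opprB addrA subrK.
  - have [g cg] := cE _ (oW _ oU).
    have [U0 UB] := sub_group oU.1.
    have /set_mem/converges_to_zeroP/(_ U oU) := coefP g.
    apply: sub_finite_set => x /= neU Ugx; apply: neU; rewrite cg.
    apply/seteqP; split=> [a [h Uh Ua]|a Ua].
      have Uhg : U (h x - g x) by exact: Uh.
      have Nhg : U (- (h x - g x)) by rewrite -[- _]add0r; exact: UB.
      have Ngx : U (- g x) by rewrite -[- _]add0r; exact: UB.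
      have := UB _ _ (UB _ _ Ua Nhg) Ngx.
      by rewrite !opprK addrA subrK subrK.
    by exists g; [exact: (coset_refl _ (subX_group (oW _ oU).1))|exact: UB].
  - move=> [g cg Vg]; exists g; last exact: VU.
    by move: cg; apply: cS; [exact: oW|exact: oW|move=> h Vh y; exact: VU].
exists f => W oW'.
have /nbhs_formal_sumsP[U oU UW] : nbhs (0 : AX) W.
  by apply: open_nbhs_nbhs; split; [exact: oW'.2|have [] := subX_group oW'.1].
exists (@coefs_in A X U); split; first exact: oW.
  by move=> g Ug; apply: UW; rewrite subr0.
have [g cg] := cE _ (oW _ oU); rewrite cg => x.
have : [set a | exists2 h : AX, c (@coefs_in A X U) h & U (a - h x)] (f x).
  by rewrite fE //; exact: (coset_refl _ (sub_group oU.1)).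
have [U0 UB] := sub_group oU.1.
rewrite cg => -[h Uh Ufh].
have Uhg : U (h x - g x) by exact: Uh.
have Ugh : U (g x - h x) by rewrite -opprB -[- _]add0r; exact: UB.
by have := UB _ _ Ufh Ugh; rewrite opprB addrA subrK.
Qed.

End FormalSumsTopology.

Section FormalSumsMap.
Variables (A B : topologicalZmodType) (X : Type) (g : A -> B).
Hypotheses (gB : zmod_morphism g) (gc : continuous g).

Let g0 : g 0 = 0. Proof. by rewrite -(subrr 0) gB subrr. Qed.

Lemma zmod_morphism_nbhs0 (N : set B) : nbhs (0 : B) N -> nbhs (0 : A) (g @^-1` N).
Proof. by move=> N0; apply: gc; rewrite g0. Qed.

Let map_subproof (f : formal_sums A X) :
  (fun x => g (f x)) \in @converging_family B X.
Proof.
rewrite inE => N N0; have /set_mem f0 := coefP f.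
exact: (f0 _ (zmod_morphism_nbhs0 N0)).
Qed.

Definition formal_sums_map (f : formal_sums A X) : formal_sums B X :=
  FormalSum (map_subproof f).

Lemma formal_sums_map_morphism : zmod_morphism formal_sums_map.
Proof. by move=> f f'; apply: formal_sumsP => x; exact: gB. Qed.

Lemma formal_sums_map_continuous : continuous formal_sums_map.
Proof.
move=> f P [N N0 NP]; exists (g @^-1` N); first exact: zmod_morphism_nbhs0.
move=> h /= hN; apply: NP => x /=.
by have := hN x; rewrite /= gB.
Qed.

End FormalSumsMap.

Section FormalSumsVect.
Variables (k : fieldType) (V : topologicalVect k) (X : Type).

Let converging_submod_closed : submod_closed (@converging_family V X).
Proof.
split=> [|a f g f0 g0]; first exact: rpred0.
suff af0 : a *: f \in @converging_family V X by exact: rpredD.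
move: f0; rewrite !inE => f0 N N0.
have aN : nbhs (0 : V) (fun v => N (a *: v)).
  have ac : continuous (fun v : V => a *: v).
    by apply: (continuous_vscale (f := fun=> a) (g := id)) => v;
      [exact: cvg_cst|exact: cvg_id].
  by apply: ac; rewrite scaler0.
exact: (f0 _ aN).
Qed.

HB.instance Definition _ := GRing.isSubmodClosed.Build k (X -> V)
  (@converging_family V X) converging_submod_closed.
HB.instance Definition _ :=
  [SubZmodule_isSubLmodule of (formal_sums V X) by <:].

Lemma coefZ (a : k) (f : formal_sums V X) x : (a *: f) x = a *: f x.
Proof. by []. Qed.

Let vscale_continuous : continuous
  (fun z : discrete_topology k * formal_sums V X => (z.1 : k) *: z.2).
Proof.
move=> [a f] P [N N0 NP] /=.
have ac : continuous (fun v : V => a *: v).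
  by apply: (continuous_vscale (f := fun=> a) (g := id)) => v;
    [exact: cvg_cst|exact: cvg_id].
have aN : nbhs (0 : V) (fun v => N (a *: v)) by apply: ac; rewrite scaler0.
exists ([set a], [set g | @coefs_in V X (fun v => N (a *: v)) (g - f)]).
  by split; [rewrite /= nbhs_principalE; exact/principal_filterP|
             exists (fun v => N (a *: v))].
move=> [b g] /= [-> gN]; apply: NP => x.
have -> : a *: g - a *: f = a *: (g - f) by rewrite scalerBr.
exact: gN.
Qed.

Definition formal_sums_vect : topologicalVect k :=
  topologicalVect_of k (formal_sums V X) vscale_continuous.
End FormalSumsVect.

Record topsc_group := TopscGroup {
  tg_sort :> topologicalZmodType;
  tg_sc : sc_topology (@subgroup tg_sort) }.

Record topsc_vect (k : fieldType) := TopscVect {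
  tv_vect :> topologicalVect k;
  tv_sc : @sc_topology tv_vect (@subspace k tv_vect) }.

Section ContinuousMorphisms.
Variables A B : topologicalZmodType.

Definition cont_morphism : {pred A -> B} :=
  mem [set f : A -> B | zmod_morphism f /\ continuous f].

Let cont_morphism_closed : zmod_closed cont_morphism.
Proof.
split=> [|f g]; rewrite !inE.
  by split=> [x y|]; [rewrite subr0|exact: cst_continuous].
move=> [fB fc] [gB gc]; split; last exact: continuous_sub.
move=> x y; change (f (x - y) - g (x - y) = (f x - g x) - (f y - g y)).
by rewrite fB gB !opprB addrACA [RHS]addrACA [- g x + _]addrC.
Qed.
HB.instance Definition _ :=
  GRing.isZmodClosed.Build (A -> B) cont_morphism cont_morphism_closed.

Record cont_hom := ContHom {
  cont_fun :> A -> B;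
  cont_funP : cont_fun \in cont_morphism }.
HB.instance Definition _ := [isSub for cont_fun].
HB.instance Definition _ := [Choice of cont_hom by <:].
HB.instance Definition _ := [SubChoice_isSubZmodule of cont_hom by <:].

Lemma cont_homP (f g : cont_hom) : (forall x, f x = g x) -> f = g.
Proof. by move=> fg; apply: val_inj; apply: funext. Qed.

Lemma cont_homB (f : cont_hom) : zmod_morphism f.
Proof. by have /set_mem[] := cont_funP f. Qed.

Lemma cont_hom_continuous (f : cont_hom) : continuous f.
Proof. by have /set_mem[] := cont_funP f. Qed.

Lemma cont_homD (f : cont_hom) : {morph f : x y / x + y}.
Proof.
move=> x y; have f0 : f 0 = 0 by rewrite -(subrr 0) cont_homB subrr.
by rewrite -[y in LHS]opprK cont_homB -[- y]add0r cont_homB f0 add0r opprK.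
Qed.

Definition mk_cont_hom (f : A -> B) (fB : zmod_morphism f)
  (fc : continuous f) : cont_hom := ContHom (mem_set (conj fB fc)).
End ContinuousMorphisms.

Section ContinuousLinear.
Variables (k : fieldType) (A B : topologicalVect k).

Definition cont_linear : {pred A -> B} :=
  mem [set f : A -> B | linear f /\ continuous f].

Let cont_linear_closed : zmod_closed cont_linear.
Proof.
split=> [|f g]; rewrite !inE.
  split=> [a x y|]; last exact: cst_continuous.
  by change (0 = a *: (0 : B) + 0); rewrite scaler0 addr0.
move=> [fL fc] [gL gc]; split; last exact: continuous_sub.
move=> a x y.
change (f (a *: x + y) - g (a *: x + y) = a *: (f x - g x) + (f y - g y)).
by rewrite fL gL scalerBr opprD addrACA.
Qed.
HB.instance Definition _ :=
  GRing.isZmodClosed.Build (A -> B) cont_linear cont_linear_closed.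

Record cont_linear_hom := ContLinearHom {
  cont_linear_fun :> A -> B;
  cont_linear_funP : cont_linear_fun \in cont_linear }.
HB.instance Definition _ := [isSub for cont_linear_fun].
HB.instance Definition _ := [Choice of cont_linear_hom by <:].
HB.instance Definition _ := [SubChoice_isSubZmodule of cont_linear_hom by <:].

Lemma cont_linear_homP (f g : cont_linear_hom) : (forall x, f x = g x) -> f = g.
Proof. by move=> fg; apply: val_inj; apply: funext. Qed.

Lemma cont_linear_homL (f : cont_linear_hom) : linear f.
Proof. by have /set_mem[] := cont_linear_funP f. Qed.

Lemma cont_linear_hom_continuous (f : cont_linear_hom) : continuous f.
Proof. by have /set_mem[] := cont_linear_funP f. Qed.

Lemma cont_linear_homB (f : cont_linear_hom) : zmod_morphism f.
Proof.
move=> x y; rewrite addrC -scaleN1r cont_linear_homL scaleN1r.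
by rewrite addrC.
Qed.

Lemma cont_linear_homD (f : cont_linear_hom) : {morph f : x y / x + y}.
Proof. by move=> x y; rewrite -[x]scale1r cont_linear_homL !scale1r. Qed.

Definition mk_cont_linear (f : A -> B) (fL : linear f)
  (fc : continuous f) : cont_linear_hom := ContLinearHom (mem_set (conj fL fc)).
End ContinuousLinear.

Section CategoryOfGroups.

Definition group_id (A : topsc_group) : cont_hom A A :=
  @mk_cont_hom A A id (fun _ _ => erefl) (fun _ => cvg_id).

Let comp_morphism (A B D : topsc_group) (g : cont_hom B D) (f : cont_hom A B) :
  zmod_morphism (g \o f).
Proof. by move=> x y /=; rewrite !cont_homB. Qed.

Let comp_continuous (A B D : topsc_group) (g : cont_hom B D)
  (f : cont_hom A B) : continuous (g \o f).
Proof.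
move=> x; apply: continuous_comp; exact: cont_hom_continuous.
Qed.

Definition group_comp (A B D : topsc_group) (g : cont_hom B D)
  (f : cont_hom A B) : cont_hom A D :=
  mk_cont_hom (@comp_morphism A B D g f) (@comp_continuous A B D g f).

Program Definition Topsc_group_preadditive : preadditive_category :=
  @PreadditiveCategory topsc_group (fun A B => cont_hom A B : zmodType)
    group_id group_comp _ _ _ _ _.
Next Obligation. by move=> *; exact: cont_homP. Qed.
Next Obligation. by move=> *; exact: cont_homP. Qed.
Next Obligation. by move=> *; exact: cont_homP. Qed.
Next Obligation. by move=> *; exact: cont_homP. Qed.
Next Obligation. by move=> *; apply: cont_homP => x; exact: cont_homD. Qed.

Definition trivial_topsc_group : topsc_group.
Proof.
exists trivial_group; apply: trivial_group_sc => //.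
Defined.

Definition prod_topsc_group (A B : topsc_group) : topsc_group.
Proof.
exists (prod_group A B); apply: (@prod_group_sc A B (@subgroup A) (@subgroup B)).
all: try done; try exact: tg_sc.
move=> U V [U0 UB] [V0 VB]; split=> // -[x y] [x' y'] /= [Ux Vy] [Ux' Vy'].
by split; [exact: UB|exact: VB].
Defined.

Program Definition Topsc_group : additive_category :=
  @AdditiveCategory Topsc_group_preadditive _ _.
Next Obligation.
exists trivial_topsc_group; split=> A f; apply: cont_homP => x.
  exact: trivial_groupE.
rewrite (trivial_groupE x (0 - 0)); exact: etrans (cont_homB f _ _) (subrr _).
Qed.
Next Obligation.
move=> A B; exists (prod_topsc_group A B).
have i1c : continuous (fun x : A => (x, 0) : prod_group A B).
  have := @continuous_pair A A B id (fun=> 0); apply; first exact: (fun=> cvg_id).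
  exact: cst_continuous.
have i2c : continuous (fun x : B => (0, x) : prod_group A B).
  have := @continuous_pair B A B (fun=> 0) id; apply; last exact: (fun=> cvg_id).
  exact: cst_continuous.
have i1B : zmod_morphism (fun x : A => (x, 0) : prod_group A B).
  by move=> x y; congr pair; rewrite subr0.
have i2B : zmod_morphism (fun x : B => (0, x) : prod_group A B).
  by move=> x y; congr pair; rewrite subr0.
have p1B : zmod_morphism (fun x : prod_group A B => x.1) by [].
have p2B : zmod_morphism (fun x : prod_group A B => x.2) by [].
have p1c : continuous (fun x : prod_group A B => x.1) by move=> x; exact: cvg_fst.
have p2c : continuous (fun x : prod_group A B => x.2) by move=> x; exact: cvg_snd.
exists (mk_cont_hom i1B i1c), (mk_cont_hom i2B i2c).
exists (mk_cont_hom p1B p1c), (mk_cont_hom p2B p2c).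
split; apply: cont_homP => //= -[x y].
by congr pair; [exact: addr0|exact: add0r].
Qed.

End CategoryOfGroups.

Section FunctorOnGroups.
Variable X : Type.

Lemma subgroup_coefs_in (A : topologicalZmodType) (U : set A) :
  subgroup U -> subgroup (@coefs_in A X U).
Proof. by move=> [U0 UB]; split=> // f g Uf Ug x; exact: UB (Uf x) (Ug x). Qed.

Definition formal_sums_group (A : topsc_group) : topsc_group :=
  @TopscGroup (formal_sums A X)
    (@formal_sums_sc A X (@subgroup A) (@subgroup (formal_sums A X))
      (fun _ => id) (fun _ => id) (@subgroup_coefs_in A) (tg_sc A)).

Definition formal_sums_hom (A B : topsc_group) (g : cont_hom A B) :
    cont_hom (formal_sums_group A) (formal_sums_group B) :=
  mk_cont_hom
    (@formal_sums_map_morphism A B X g (cont_homB g) (@cont_hom_continuous A B g))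
    (@formal_sums_map_continuous A B X g (cont_homB g)
       (@cont_hom_continuous A B g)).

Program Definition formal_sums_group_functor :
    additive_functor Topsc_group Topsc_group :=
  @AdditiveFunctor Topsc_group Topsc_group formal_sums_group formal_sums_hom _ _ _.
Next Obligation. by move=> A; apply: cont_homP => f; exact: formal_sumsP. Qed.
Next Obligation.
by move=> A B E g f; apply: cont_homP => h; exact: formal_sumsP.
Qed.
Next Obligation.
by move=> A B f g; apply: cont_homP => h; exact: formal_sumsP.
Qed.
End FunctorOnGroups.

Section CategoryOfVects.
Variable k : fieldType.

Definition vect_id (A : topsc_vect k) : cont_linear_hom A A :=
  @mk_cont_linear k A A id (fun _ _ _ => erefl) (fun _ => cvg_id).

Let comp_linear (A B D : topsc_vect k) (g : cont_linear_hom B D)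
  (f : cont_linear_hom A B) : linear (g \o f).
Proof. by move=> a x y /=; rewrite !cont_linear_homL. Qed.

Let comp_continuous (A B D : topsc_vect k) (g : cont_linear_hom B D)
  (f : cont_linear_hom A B) : continuous (g \o f).
Proof.
by move=> x; apply: continuous_comp; exact: cont_linear_hom_continuous.
Qed.

Definition vect_comp (A B D : topsc_vect k) (g : cont_linear_hom B D)
  (f : cont_linear_hom A B) : cont_linear_hom A D :=
  mk_cont_linear (@comp_linear A B D g f) (@comp_continuous A B D g f).

Program Definition Topsc_vect_preadditive : preadditive_category :=
  @PreadditiveCategory (topsc_vect k)
    (fun A B => cont_linear_hom A B : zmodType) vect_id vect_comp _ _ _ _ _.
Next Obligation. by move=> *; exact: cont_linear_homP. Qed.
Next Obligation. by move=> *; exact: cont_linear_homP. Qed.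
Next Obligation. by move=> *; exact: cont_linear_homP. Qed.
Next Obligation. by move=> *; exact: cont_linear_homP. Qed.
Next Obligation.
by move=> *; apply: cont_linear_homP => x; exact: cont_linear_homD.
Qed.

Definition trivial_topsc_vect : topsc_vect k.
Proof.
exists (trivial_vect k).
apply: (@trivial_group_sc (@subspace k (trivial_vect k))) => //.
by move=> U; exact: subspace_subgroup.
Defined.

Definition prod_topsc_vect (A B : topsc_vect k) : topsc_vect k.
Proof.
exists (prod_vect A B).
apply: (@prod_group_sc A B (@subspace k A) (@subspace k B)
  (@subspace k (prod_vect A B))); try exact: tv_sc; try done.
- by move=> U; exact: subspace_subgroup.
- by move=> U; exact: subspace_subgroup.
- by move=> U; exact: subspace_subgroup.
move=> U V [U0 UL] [V0 VL]; split=> // a [x y] [x' y'] /= [Ux Vy] [Ux' Vy'].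
by split; [exact: UL|exact: VL].
Defined.

Program Definition Topsc_vect : additive_category :=
  @AdditiveCategory Topsc_vect_preadditive _ _.
Next Obligation.
exists trivial_topsc_vect; split=> A f; apply: cont_linear_homP => x.
  exact: trivial_groupE.
rewrite (trivial_groupE x (0 - 0)).
exact: etrans (cont_linear_homB f _ _) (subrr _).
Qed.
Next Obligation.
move=> A B; exists (prod_topsc_vect A B).
have i1c : continuous (fun x : A => (x, 0) : prod_vect A B).
  have := @continuous_pair A A B id (fun=> 0); apply; first exact: (fun=> cvg_id).
  exact: cst_continuous.
have i2c : continuous (fun x : B => (0, x) : prod_vect A B).
  have := @continuous_pair B A B (fun=> 0) id; apply; last exact: (fun=> cvg_id).
  exact: cst_continuous.
have i1L : linear (fun x : A => (x, 0) : prod_vect A B).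
  by move=> a x y; congr pair; exact/esym/(etrans (addr0 _) (scaler0 _ _)).
have i2L : linear (fun x : B => (0, x) : prod_vect A B).
  by move=> a x y; congr pair; exact/esym/(etrans (addr0 _) (scaler0 _ _)).
have p1L : linear (fun x : prod_vect A B => x.1 : A) by [].
have p2L : linear (fun x : prod_vect A B => x.2 : B) by [].
have p1c : continuous (fun x : prod_vect A B => x.1 : A).
  by move=> x; exact: cvg_fst.
have p2c : continuous (fun x : prod_vect A B => x.2 : B).
  by move=> x; exact: cvg_snd.
exists (mk_cont_linear i1L i1c), (mk_cont_linear i2L i2c).
exists (mk_cont_linear p1L p1c), (mk_cont_linear p2L p2c).
split; apply: cont_linear_homP => //= -[x y].
by congr pair; [exact: addr0|exact: add0r].
Qed.

End CategoryOfVects.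

Section FunctorOnVects.
Variables (k : fieldType) (X : Type).

Lemma subspace_coefs_in (V : topologicalVect k) (U : set V) :
  subspace U -> @subspace k (formal_sums_vect V X) (@coefs_in V X U).
Proof. by move=> [U0 UL]; split=> // a f g Uf Ug x; exact: UL (Uf x) (Ug x). Qed.

Definition formal_sums_topsc_vect (V : topsc_vect k) : topsc_vect k :=
  @TopscVect k (formal_sums_vect V X)
    (@formal_sums_sc V X (@subspace k V) (@subspace k (formal_sums_vect V X))
      (@subspace_subgroup k V) (@subspace_subgroup k (formal_sums_vect V X))
      (@subspace_coefs_in V) (tv_sc V)).

Lemma formal_sums_map_linear (V W : topsc_vect k) (g : cont_linear_hom V W) :
  linear (@formal_sums_map V W X g (cont_linear_homB g)
            (@cont_linear_hom_continuous k V W g)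
          : formal_sums_vect V X -> formal_sums_vect W X).
Proof.
by move=> a f f'; apply: formal_sumsP => x; exact: cont_linear_homL.
Qed.

Definition formal_sums_linear_hom (V W : topsc_vect k)
    (g : cont_linear_hom V W) :
    cont_linear_hom (formal_sums_topsc_vect V) (formal_sums_topsc_vect W) :=
  mk_cont_linear (formal_sums_map_linear g)
    (@formal_sums_map_continuous V W X g (cont_linear_homB g)
       (@cont_linear_hom_continuous k V W g)).

Program Definition formal_sums_vect_functor :
    additive_functor (Topsc_vect k) (Topsc_vect k) :=
  @AdditiveFunctor (Topsc_vect k) (Topsc_vect k)
    formal_sums_topsc_vect formal_sums_linear_hom _ _ _.
Next Obligation.
by move=> A; apply: cont_linear_homP => f; exact: formal_sumsP.
Qed.
Next Obligation.
by move=> A B E g f; apply: cont_linear_homP => h; exact: formal_sumsP.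
Qed.
Next Obligation.
by move=> A B f g; apply: cont_linear_homP => h; exact: formal_sumsP.
Qed.
End FunctorOnVects.

(* Main.v *)
Require Import Defs.
From HB Require Import structures.
From mathcomp Require Import all_boot all_algebra finmap all_classical.
From mathcomp Require Import topology tvs generic_quotient ring_quotient.
Require Import Defs.

(** The maximal exact structure consists of the sequences
    [0 -> K -> A -> C -> 0] in which [K] carries the topology induced from [A],
    [K] is the kernel of [A -> C], and [A -> C] is surjective and open. Hence,
    if [-[[X]]] is exact, [A[[X]] -> C[[X]]] is surjective for every such
    sequence: every family in [C] converging to zero and indexed by [X] lifts to
    a family in [A] converging to zero. It remains to find an open surjection
    along which some null family does not lift.

    Let [G] be any complete, separated topological vector space, [I] an
    uncountable set and [A] the direct sum of copies of [G] indexed by [I], with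
    the subspaces [box F W] as a base of neighborhoods of zero: the families
    that vanish on the countable set [F] and have all their terms in the open
    subspace [W]. Then [A] is complete ([box_complete]): a limit exists
    coordinatewise, and its support is finite because it is so on every
    countable set. The sum map [A -> G] is continuous, and it is open because a
    countable [F] always leaves a coordinate free ([total_box]). On the other
    hand the supports of the terms of a sequence in [A] lie in one countable set
    [F], and being in [box F W] then forces a term to be zero; so a null family
    in [A] has only finitely many nonzero terms along any sequence of distinct
    indices ([no_null_lift]). For [G] the space of all sequences of scalars with
    the product topology, the unit vectors form a null family with infinitely
    many nonzero terms. Forgetting the scalars gives the example for groups.

    That the class above is an exact structure, and the largest one, is proved
    for groups and vector spaces at once, in a [linear_category]. The delicate
    point among the axioms is the pushout of [A -> B] along [A -> A'], namely
    the quotient of [B + A'] by the antidiagonal image of [A]; it has to be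
    complete although quotients of complete groups need not be so, and it is,
    being an extension of [B/A] by [A'] ([antidiagonal_complete]). For
    maximality, let [A -> C] be an admissible epimorphism of some exact
    structure. Its pullback along the morphism from a discrete object given by
    an element of [C] is again an epimorphism, hence surjective, and lifts that
    element ([exact_epi_surjective]); openness follows from the universal
    property of the cokernel, tested on discrete quotients of [A]
    ([cokernel_open]). *)

Set Implicit Arguments.
Unset Strict Implicit.
Unset Printing Implicit Defensive.

Import GRing.Theory.
Local Open Scope classical_set_scope.
Local Open Scope ring_scope.
Local Open Scope quotient_scope.

(** * Linear topologies in terms of open subgroups *)

Section Subgroups.
Variables (A : zmodType) (U : set A).
Hypothesis sU : subgroup U.

Lemma subgroupN x : U x -> U (- x).
Proof. by move=> Ux; rewrite -[- x]add0r; apply: sU.2 => //; exact: sU.1. Qed.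

Lemma subgroupD x y : U x -> U y -> U (x + y).
Proof. by move=> Ux Uy; rewrite -[y]opprK; apply: sU.2 => //; exact: subgroupN. Qed.

Lemma subgroupBC x y : U (x - y) -> U (y - x).
Proof. by move=> /subgroupN; rewrite opprB. Qed.

Lemma subgroupB_trans y x z : U (x - y) -> U (y - z) -> U (x - z).
Proof. by move=> xy /(subgroupD xy); rewrite addrA subrK. Qed.
End Subgroups.

Definition sub_add (A : zmodType) (U K : set A) : set A :=
  [set x | exists2 k, K k & U (x - k)].

Section SubAdd.
Variables (A : zmodType) (U K : set A).
Hypotheses (sU : subgroup U) (sK : subgroup K).

Lemma subgroup_sub_add : subgroup (sub_add U K).
Proof.
split=> [|x y [k Kk Uk] [l Kl Ul]]; last first.
  exists (k - l); first exact: sK.2.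
  by rewrite opprB [l - k]addrC addrACA [- y + l]addrC -[l - y]opprB; exact: sU.2.
by exists 0; rewrite ?subr0; [exact: sK.1|exact: sU.1].
Qed.

Lemma sub_addl : U `<=` sub_add U K.
Proof. by move=> x Ux; exists 0; rewrite ?subr0 //; exact: sK.1. Qed.

Lemma sub_addr : K `<=` sub_add U K.
Proof. by move=> x Kx; exists x; rewrite ?subrr //; exact: sU.1. Qed.

Lemma sub_add_mono (V : set A) : V `<=` U -> sub_add V K `<=` sub_add U K.
Proof. by move=> VU x [k Kk /VU]; exists k. Qed.
End SubAdd.

Lemma zmod_morphism0 (A B : zmodType) (f : A -> B) : zmod_morphism f -> f 0 = 0.
Proof. by move=> fB; rewrite -(subrr 0) fB subrr. Qed.

Lemma zmod_morphismN (A B : zmodType) (f : A -> B) :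
  zmod_morphism f -> {morph f : x / - x}.
Proof. by move=> fB x; rewrite -sub0r fB (zmod_morphism0 fB) sub0r. Qed.

Lemma zmod_morphismD (A B : zmodType) (f : A -> B) :
  zmod_morphism f -> {morph f : x y / x + y}.
Proof. by move=> fB x y; rewrite -[y in LHS]opprK fB (zmod_morphismN fB) opprK. Qed.

Lemma nbhs_shift (A : topologicalZmodType) (x : A) (P : set A) :
  nbhs (0 : A) P -> nbhs x [set y | P (y - x)].
Proof.
move=> P0; have c : continuous (fun y : A => y - x).
  by apply: (continuous_sub (f := id) (g := fun=> x)) => y;
    [exact: cvg_id|exact: cvg_cst].
by apply: c; rewrite subrr.
Qed.

Lemma nbhs_unshift (A : topologicalZmodType) (x : A) (P : set A) :
  nbhs x P -> nbhs (0 : A) [set y | P (y + x)].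
Proof.
move=> Px; have c : continuous (fun y : A => y - (- x)).
  by apply: (continuous_sub (f := id) (g := fun=> - x)) => y;
    [exact: cvg_id|exact: cvg_cst].
suff : nbhs (0 : A) (fun y => P (y - (- x))).
  by apply: filterS => y /=; rewrite opprK.
by apply: c; rewrite opprK add0r.
Qed.

Section OpenSubgroups.
Variables (A : topologicalZmodType) (sub : set (set A)).
Hypothesis sub_group : forall U, sub U -> subgroup U.

Lemma open_sub_nbhs U : open_sub sub U -> nbhs (0 : A) U.
Proof.
by move=> [sU oU]; apply: open_nbhs_nbhs; split=> //; exact: (sub_group sU).1.
Qed.

Lemma open_sub_above U V : sub V -> open_sub sub U -> U `<=` V -> open_sub sub V.
Proof.
move=> sV oU UV; split=> //; rewrite openE => x Vx.
apply: filterS (nbhs_shift x (open_sub_nbhs oU)) => y /= /UV Vyx.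
by rewrite -(subrK x y); exact: (subgroupD (sub_group sV)).
Qed.

(** Completeness with a representative [c U] of the coset of each open
    subgroup [U] in place of the coset itself. *)
Lemma complete_limit (c : set A -> A) : complete_topology sub ->
  (forall U V, open_sub sub U -> open_sub sub V -> V `<=` U -> U (c V - c U)) ->
  exists a, forall U, open_sub sub U -> U (c U - a).
Proof.
move=> com cc.
have [|a ca] := com (fun U => coset U (c U)).
  split=> [U oU|U V oU oV VU x Vx]; first by exists (c U).
  have sU := sub_group oU.1.
  by apply: (subgroupB_trans sU (y := c V)); [exact: VU|exact: cc].
exists a => U oU; have := ca _ oU.
by move=> /(cosetE _ _ (sub_group oU.1)).
Qed.

Lemma sepP (a : A) : separated_topology sub ->
  (forall U, open_sub sub U -> U a) -> a = 0.
Proof.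
move=> sep aU; apply: sep => U oU; apply/cosetE; first exact: sub_group oU.1.
by rewrite subr0; exact: aU.
Qed.

(** The two properties of a subgroup [K] that make [A/K] separated,
    respectively complete: the images of the open subgroups [U] form a base of
    neighborhoods of zero in [A/K], and [U + K] is the preimage of such an
    image. *)
Definition closed_subgroup (K : set A) : Prop := forall a,
  (forall U, open_sub sub U -> sub_add U K a) -> K a.

Definition complete_modulo (K : set A) : Prop := forall c : set A -> A,
  (forall U V, open_sub sub U -> open_sub sub V -> V `<=` U ->
     sub_add U K (c V - c U)) ->
  exists a, forall U, open_sub sub U -> sub_add U K (c U - a).
End OpenSubgroups.

Section Morphisms.
Variables (A B : topologicalZmodType) (subA : set (set A)) (subB : set (set B)).
Variable f : A -> B.
Hypothesis fB : zmod_morphism f.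

Lemma morphism_continuous :
  (forall U, subA U -> subgroup U) -> linear_topology subB ->
  (forall V, open_sub subB V -> exists2 U, open_sub subA U & U `<=` f @^-1` V) ->
  continuous f.
Proof.
move=> sA linB H x P /nbhs_unshift/linB[V oV VP].
have [U oU UV] := H V oV.
apply: filterS (nbhs_shift x (open_sub_nbhs sA oU)) => y /= /UV /= /VP /=.
by rewrite fB subrK.
Qed.

(** The topology of [A] is induced from [B]; if [A] is separated, injectivity
    follows. *)
Definition linear_embedding : Prop := forall U, open_sub subA U ->
  exists2 V, open_sub subB V & f @^-1` V `<=` U.

Definition open_surjection : Prop := (forall b, exists a, f a = b) /\
  forall U, open_sub subA U -> exists2 V, open_sub subB V & V `<=` f @` U.

Lemma embedding_inj : (forall U, subA U -> subgroup U) ->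
    (forall U, subB U -> subgroup U) ->
  separated_topology subA -> linear_embedding -> injective f.
Proof.
move=> sA sB sep emb x y fxy; apply: sep => U oU.
apply/(cosetE _ _ (sA _ oU.1)).
have [V oV VU] := emb U oU; apply: VU; rewrite /= fB fxy subrr.
exact: (sB _ oV.1).1.
Qed.
End Morphisms.

(** * Additive categories of linearly topologized modules *)

(** What the proof uses of complete, separated topological groups and vector
    spaces: [sub] is the class of all subgroups, respectively subspaces;
    in [point_object], [Z] stands for the discrete group of integers,
    respectively the discrete line. *)
Record linear_category := LinearCategory {
  lcat :> additive_category;
  car : lcat -> topologicalZmodType;
  sub : forall A, set (set (car A));
  fn : forall A B : lcat, hom A B -> car A -> car B;
  sub_subgroup : forall A (U : set (car A)), sub U -> subgroup U;
  car_sc : forall A, sc_topology (@sub A);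
  sub_zero : forall A, sub ([set 0] : set (car A));
  sub_setI : forall A (U V : set (car A)), sub U -> sub V -> sub (U `&` V);
  sub_preimage : forall A B (f : hom A B) U, sub U -> sub (fn f @^-1` U);
  sub_image : forall A B (f : hom A B) U, sub U -> sub (fn f @` U);
  fn_inj : forall A B (f g : hom A B), (forall x, fn f x = fn g x) -> f = g;
  fn1 : forall A (x : car A), fn (idm A) x = x;
  fnM : forall A B C (g : hom B C) (f : hom A B) x, fn (g \oc f) x = fn g (fn f x);
  fnD : forall A B (f g : hom A B) x, fn (f + g) x = fn f x + fn g x;
  fn_zmod : forall A B (f : hom A B), zmod_morphism (fn f);
  fn_continuous : forall A B (f : hom A B), continuous (fn f);
  fn_lift : forall K A T (i : hom K A) (f : hom T A),
    linear_embedding (@sub K) (@sub A) (fn i) ->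
    (forall t, exists x, fn i x = fn f t) ->
    exists g : hom T K, forall t, fn i (fn g t) = fn f t;
  fn_descent : forall A B T (p : hom A B) (f : hom A T),
    open_surjection (@sub A) (@sub B) (fn p) ->
    (forall x, fn p x = 0 -> fn f x = 0) ->
    exists g : hom B T, forall x, fn g (fn p x) = fn f x;
  kernel_object : forall A B (f : hom A B), exists K (i : hom K A),
    linear_embedding (@sub K) (@sub A) (fn i) /\
    forall x, fn f x = 0 <-> exists y, fn i y = x;
  quotient_object : forall A (K : set (car A)), sub K ->
    closed_subgroup (@sub A) K -> complete_modulo (@sub A) K ->
    exists Q (q : hom A Q),
      open_surjection (@sub A) (@sub Q) (fn q) /\ forall x, fn q x = 0 <-> K x;
  point_object : exists Z (z : car Z), open_sub (@sub Z) [set 0] /\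
    forall A (a : car A), exists f : hom Z A, fn f z = a }.

Section ExactStructure.
Variable C : linear_category.
Implicit Types A B D K T : C.
Local Notation osub A := (open_sub (@sub C A)).
Local Notation embedding i := (linear_embedding (@sub C _) (@sub C _) (fn i)).
Local Notation open_epi p := (open_surjection (@sub C _) (@sub C _) (fn p)).
Local Notation sG := (@sub_subgroup C _ _).

Lemma fn_0 A B (f : hom A B) : fn f 0 = 0.
Proof. exact: zmod_morphism0 (@fn_zmod _ _ _ f). Qed.

Lemma fn_B A B (f : hom A B) x y : fn f (x - y) = fn f x - fn f y.
Proof. exact: fn_zmod. Qed.

Lemma fn_N A B (f : hom A B) x : fn f (- x) = - fn f x.
Proof. by rewrite -sub0r fn_B fn_0 sub0r. Qed.

Lemma fn_D A B (f : hom A B) x y : fn f (x + y) = fn f x + fn f y.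
Proof. exact: zmod_morphismD (@fn_zmod _ _ _ f) _ _. Qed.

Lemma fn0 A B x : fn (0 : hom A B) x = 0.
Proof. by apply: (addIr (fn (0 : hom A B) x)); rewrite -fnD addr0 add0r. Qed.

Lemma fnN A B (f : hom A B) x : fn (- f) x = - fn f x.
Proof. by apply: (addIr (fn f x)); rewrite -fnD addNr fn0 addNr. Qed.

Lemma fnB A B (f g : hom A B) x : fn (f - g) x = fn f x - fn g x.
Proof. by rewrite fnD fnN. Qed.

Lemma sub_full A : sub ([set: car A]).
Proof.
have -> : [set: car A] = fn (0 : hom A A) @^-1` [set 0].
  by apply/seteqP; split=> // x _; rewrite /= fn0.
exact/sub_preimage/sub_zero.
Qed.

Lemma osub_full A : osub A setT.
Proof. by split; [exact: sub_full|exact: openT]. Qed.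

Lemma osub0 A U : osub A U -> U 0.
Proof. by move=> [/sG[]]. Qed.

Lemma osub_preimage A B (f : hom A B) U : osub B U -> osub A (fn f @^-1` U).
Proof.
move=> [sU oU]; split; first exact: sub_preimage.
by apply: open_comp => // x _; exact: fn_continuous.
Qed.

Lemma osub_setI A U V : osub A U -> osub A V -> osub A (U `&` V).
Proof. by move=> [? ?] [? ?]; split; [exact: sub_setI|exact: openI]. Qed.

Lemma osub_above A (U V : set (car A)) : sub V -> osub A U -> U `<=` V -> osub A V.
Proof. exact: (open_sub_above (@sub_subgroup C A)). Qed.

Lemma eq0_osub A (a : car A) : (forall U, osub A U -> U a) -> a = 0.
Proof. by have [_ sep _] := car_sc A; exact: (sepP (@sub_subgroup C A)). Qed.

Lemma osub_limit A (c : set (car A) -> car A) :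
  (forall U V, osub A U -> osub A V -> V `<=` U -> U (c V - c U)) ->
  exists a, forall U, osub A U -> U (c U - a).
Proof.
by have [_ _ com] := car_sc A; exact: (complete_limit (@sub_subgroup C A)).
Qed.

Lemma embedding_injective A B (i : hom A B) : embedding i -> injective (fn i).
Proof.
have [_ sep _] := car_sc A.
by apply: embedding_inj sep; [exact: fn_zmod|exact: sub_subgroup|exact: sub_subgroup].
Qed.

Lemma osub_image A B (p : hom A B) U : open_epi p -> osub A U -> osub B (fn p @` U).
Proof.
move=> [_ op] oU; have [V oV VU] := op U oU.
by apply: osub_above oV VU; exact/sub_image/oU.1.
Qed.

Lemma idm_embedding A : embedding (idm A).
Proof. by move=> U oU; exists U => // x /=; rewrite fn1. Qed.

Lemma idm_open_epi A : open_epi (idm A).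
Proof.
split=> [a|U oU]; first by exists a; rewrite fn1.
by exists U => // x Ux; exists x; rewrite ?fn1.
Qed.

Lemma comp_embedding A B D (f : hom A B) (g : hom B D) :
  embedding f -> embedding g -> embedding (g \oc f).
Proof.
move=> ef eg U /ef[V /eg[W oW WV] VU].
by exists W => // x /=; rewrite fnM => /WV/VU.
Qed.

Lemma comp_open_epi A B D (f : hom A B) (g : hom B D) :
  open_epi f -> open_epi g -> open_epi (g \oc f).
Proof.
move=> [sf of_] [sg og]; split=> [d|U oU].
  by have [b <-] := sg d; have [a <-] := sf b; exists a; rewrite fnM.
have [V /og[W oW WV] VU] := of_ U oU.
exists W => // d /WV[b /VU[a Ua <-] <-]; exists a => //; exact: fnM.
Qed.

(** The sequences of the maximal exact structure, in terms of elements. *)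
Definition strict_exact (S : short_seq C) : Prop :=
  [/\ embedding (seq_inj S), open_epi (seq_prj S) &
      forall x, fn (seq_prj S) x = 0 <-> exists y, fn (seq_inj S) y = x].

Lemma admissible_epiP A B (p : hom A B) :
  admissible_epi strict_exact p <-> open_epi p.
Proof.
split=> [[K [i [_ op _]]] //|op].
by have [K [i [ei ki]]] := kernel_object p; exists K, i; split.
Qed.

Lemma strict_exact_kernel S : strict_exact S -> is_kernel (seq_inj S) (seq_prj S).
Proof.
case: S => K A B i p [/= ei _ kp]; split=> [|T f pf].
  by apply: fn_inj => x; rewrite fnM fn0; apply/kp; exists x.
have [t|g gE] := fn_lift (f := f) ei.
  by apply/kp; rewrite -fnM pf fn0.
exists g; split=> [|g' g'E]; apply: fn_inj => t; first by rewrite fnM gE.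
by apply: (embedding_injective ei); rewrite gE -g'E fnM.
Qed.

Lemma strict_exact_cokernel S :
  strict_exact S -> is_cokernel (seq_prj S) (seq_inj S).
Proof.
case: S => K A B i p [/= _ op kp]; split=> [|T f fi].
  by apply: fn_inj => x; rewrite fnM fn0; apply/kp; exists x.
have [x /kp[y <-]|g gE] := fn_descent (f := f) op; first by rewrite -fnM fi fn0.
exists g; split=> [|g' g'E]; apply: fn_inj => t; first by rewrite fnM gE.
by have [a <-] := op.1 t; rewrite gE -g'E fnM.
Qed.

Lemma iso_embedding A B (f : hom A B) : is_iso f -> embedding f.
Proof.
move=> [g [gf fg]] U oU; exists (fn g @^-1` U); first exact: osub_preimage.
by move=> x /=; rewrite -fnM gf fn1.
Qed.

Lemma iso_open_epi A B (f : hom A B) : is_iso f -> open_epi f.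
Proof.
move=> [g [gf fg]]; split=> [b|U oU]; first by exists (fn g b); rewrite -fnM fg fn1.
exists (fn g @^-1` U); first exact: osub_preimage.
by move=> b /= Ub; exists (fn g b) => //; rewrite -fnM fg fn1.
Qed.

Lemma open_epi_cancel A B D (f : hom A B) (g : hom B D) :
  open_epi (g \oc f) -> open_epi g.
Proof.
move=> [sgf ogf]; split=> [d|U oU].
  by have [a <-] := sgf d; exists (fn f a); rewrite fnM.
have [W oW WU] := ogf _ (osub_preimage f oU).
by exists W => // d /WU[a Ua <-]; exists (fn f a) => //; rewrite fnM.
Qed.

Lemma iso_inv A B (f : hom A B) (g : hom B A) :
  g \oc f = idm A -> f \oc g = idm B -> is_iso g.
Proof. by exists f. Qed.

Lemma iso_inj A B (f : hom A B) : is_iso f -> injective (fn f).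
Proof. by move=> /iso_embedding/embedding_injective. Qed.

Lemma strict_exact_iso (S S' : short_seq C) :
  strict_exact S -> short_seq_iso S S' -> strict_exact S'.
Proof.
case: S S' => K A B i p [K' A' B' i' p'] [/= ei op kp] [/= a [b [c]]].
move=> [[a' [a'a aa']] isob isoc bi cp].
have isoa : is_iso a by exists a'.
split=> /=.
- have -> : i' = (b \oc i) \oc a' by rewrite bi -compA aa' compm1.
  apply: comp_embedding; first exact: iso_embedding (iso_inv a'a aa').
  by apply: comp_embedding ei _; exact: iso_embedding.
- apply: (open_epi_cancel (f := b)); rewrite -cp.
  by apply: comp_open_epi op _; exact: iso_open_epi.
- move=> x'; have [x <-] := (iso_open_epi isob).1 x'.
  rewrite -fnM -cp fnM; split=> [|[y' y'x]].
    rewrite -(fn_0 c) => /(iso_inj isoc)/kp[y <-].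
    by exists (fn a y); rewrite -!fnM bi.
  have [y yy'] := (iso_open_epi isoa).1 y'.
  have -> : x = fn i y; last first.
    have -> : fn p (fn i y) = 0 by apply/kp; exists y.
    exact: fn_0.
  by apply: (iso_inj isob); rewrite -y'x -yy' -!fnM bi.
Qed.

Lemma zero_objectE (Z : C) : is_zero_object Z -> forall x : car Z, x = 0.
Proof. by move=> [Z0 _] x; rewrite -(fn1 x) (Z0 _ (idm Z)) fn0. Qed.

Lemma idm_admissible_mono A : admissible_mono strict_exact (idm A).
Proof.
have [Z Z0] := has_zero_object C; exists Z, 0; split=> /=.
- exact: idm_embedding.
- split=> [b|U oU]; first by exists 0; rewrite fn_0 (zero_objectE Z0 b).
  exists setT; first exact: osub_full.
  move=> z _; exists 0; first exact: osub0 oU.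
  by rewrite fn_0 (zero_objectE Z0 z).
- by move=> x; rewrite fn0; split=> // _; exists x; rewrite fn1.
Qed.

(** ** Pullbacks and pushouts *)

Lemma biproduct_split A B P i1 i2 p1 p2 : @is_biproduct C A B P i1 i2 p1 p2 ->
  [/\ forall x, fn p1 (fn i1 x) = x, forall x, fn p2 (fn i2 x) = x,
      forall x, fn p1 (fn i2 x) = 0, forall x, fn p2 (fn i1 x) = 0 &
      forall x, fn i1 (fn p1 x) + fn i2 (fn p2 x) = x].
Proof.
move=> [e11 e22 e12 e21 e]; split=> x; rewrite -!fnM ?e11 ?e22 ?e12 ?e21 ?fn1 ?fn0 //.
by rewrite -fnD e fn1.
Qed.

Lemma biproduct_osub A B P i1 i2 p1 p2 U : @is_biproduct C A B P i1 i2 p1 p2 ->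
  osub P U -> exists U1 U2, [/\ osub A U1, osub B U2 &
    forall x, U1 (fn p1 x) -> U2 (fn p2 x) -> U x].
Proof.
move=> /biproduct_split[_ _ _ _ e] oU.
exists (fn i1 @^-1` U), (fn i2 @^-1` U); split; try exact: osub_preimage.
by move=> x U1 U2; rewrite -[x]e; exact: (subgroupD (sG oU.1)).
Qed.

Lemma strict_pullback B A' B' (f' : hom A' B') (g' : hom B B') : open_epi f' ->
  exists A (f : hom A B) (g : hom A A'), is_pullback f g f' g' /\ open_epi f.
Proof.
move=> [sf of_].
have [P [i1 [i2 [p1 [p2 bip]]]]] := has_biproducts B A'.
have [e11 e22 e12 e21 e] := biproduct_split bip.
have [A [i [ei ki]]] := kernel_object (g' \oc p1 - f' \oc p2).
have kP x : fn g' (fn p1 x) = fn f' (fn p2 x) -> exists y, fn i y = x.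
  by move=> eqx; apply/ki; rewrite fnB !fnM eqx subrr.
have Pk y : fn g' (fn p1 (fn i y)) = fn f' (fn p2 (fn i y)).
  have /ki/eqP : exists y', fn i y' = fn i y by exists y.
  by rewrite fnB !fnM subr_eq0 => /eqP.
exists A, (p1 \oc i), (p2 \oc i); split; last first.
  split=> [b|U oU].
    have [a' a'b] := sf (fn g' b).
    have [|y yE] := kP (fn i1 b + fn i2 a').
      by rewrite (fn_D p1) (fn_D p2) e11 e12 e21 e22 addr0 add0r.
    by exists y; rewrite fnM yE fn_D e11 e12 addr0.
  have [V oV VU] := ei U oU.
  have [V1 [V2 [oV1 oV2 VV]]] := biproduct_osub bip oV.
  have [W oW WV] := of_ _ oV2.
  exists (V1 `&` fn g' @^-1` W); first exact/osub_setI/osub_preimage.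
  move=> b /= [V1b /WV[a' V2a' a'b]].
  have [|y yE] := kP (fn i1 b + fn i2 a').
    by rewrite (fn_D p1) (fn_D p2) e11 e12 e21 e22 addr0 add0r.
  exists y; last by rewrite fnM yE fn_D e11 e12 addr0.
  by apply: VU; rewrite /= yE; apply: VV; rewrite fn_D ?e11 ?e12 ?e21 ?e22 ?addr0 ?add0r.
split=> [|T u v uv]; first by apply: fn_inj => y; rewrite !fnM Pk.
have [t|w wE] := fn_lift (f := i1 \oc u + i2 \oc v) ei.
  apply: kP; rewrite fnD !fnM (fn_D p1) (fn_D p2) e11 e12 e21 e22 addr0 add0r.
  by rewrite -!fnM uv.
have w1 t : fn p1 (fn i (fn w t)) = fn u t.
  by rewrite wE fnD !fnM fn_D e11 e12 addr0.
have w2 t : fn p2 (fn i (fn w t)) = fn v t.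
  by rewrite wE fnD !fnM fn_D e21 e22 add0r.
exists w; split=> [|w' [w'u w'v]].
  by split; apply: fn_inj => t; rewrite !fnM.
apply: fn_inj => t; apply: (embedding_injective ei).
by rewrite wE -w'u -w'v fnD !fnM e.
Qed.

Section Antidiagonal.
Variables (A B A' P : C) (f : hom A B) (g : hom A A').
Variables (i1 : hom B P) (i2 : hom A' P) (p1 : hom P B) (p2 : hom P A').
Variables (Q : C) (p : hom B Q).
Hypotheses (bip : is_biproduct i1 i2 p1 p2) (ex : strict_exact (ShortSeq f p)).

Let ef : embedding f. Proof. by case: ex. Qed.
Let op : open_epi p. Proof. by case: ex. Qed.
Let kp x : fn p x = 0 <-> exists y, fn f y = x. Proof. by case: ex. Qed.

Definition antidiagonal : set (car P) := fn (i1 \oc f - i2 \oc g) @` setT.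
Local Notation K := antidiagonal.

Let sK : subgroup K. Proof. exact/sG/sub_image/sub_full. Qed.

Lemma antidiagonalP x :
  K x <-> exists a, fn f a = fn p1 x /\ fn p2 x = - fn g a.
Proof.
have [e11 e22 e12 e21 e] := biproduct_split bip.
split=> [[a _ <-]|[a [ax xa]]]; exists a => //.
  by rewrite fnB !fnM !fn_B e11 e12 e21 e22 subr0 sub0r.
by rewrite fnB !fnM ax -fn_N -xa e.
Qed.

(** The topology of [A'] is induced from [P/K]: if [(0, a')] is close to an
    element [(f a, - g a)] of [K], then [f a] is small, hence so is [g a]
    because [f] is an embedding, and [a'] is close to [- g a]. *)
Lemma antidiagonal_embedding W : osub A' W ->
  exists2 U, osub P U & forall a', sub_add U K (fn i2 a') -> W a'.
Proof.
have [e11 e22 e12 e21 e] := biproduct_split bip.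
move=> oW; have [U1 oU1 U1W] := ef (osub_preimage g oW).
exists (fn p1 @^-1` U1 `&` fn p2 @^-1` W).
  by apply: osub_setI; exact: osub_preimage.
move=> a' [k /antidiagonalP[a [ak ka]] [/=]].
rewrite !fn_B e12 e22 sub0r -ak ka opprK => /(subgroupN (sG oU1.1)).
rewrite opprK => /U1W /= Wa Wa'.
by rewrite -(addrK (fn g a) a'); apply: (sG oW.1).2.
Qed.

Let pp1K x : K x -> fn (p \oc p1) x = 0.
Proof. by move=> /antidiagonalP[a [ax _]]; rewrite fnM; apply/kp; exists a. Qed.

Let pp1_lift x : fn (p \oc p1) x = 0 -> exists a', K (x - fn i2 a').
Proof.
have [e11 e22 e12 e21 e] := biproduct_split bip.
rewrite fnM => /kp[a ax]; exists (fn p2 x + fn g a); apply/antidiagonalP.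
exists a; split; first by rewrite fn_B e12 subr0.
by rewrite fn_B e22 opprD addNKr.
Qed.

Lemma antidiagonal_sum_open_epi : open_epi (p \oc p1).
Proof.
have [e11 e22 e12 e21 e] := biproduct_split bip.
apply: comp_open_epi op; split=> [b|U oU]; first by exists (fn i1 b).
exists (fn i1 @^-1` U); first exact: osub_preimage.
by move=> b /= Ub; exists (fn i1 b).
Qed.

(** The closure of [K] dies in the separated object [Q], so that modulo [K] it
    comes from [A'], where it is zero because [A'] is separated. *)
Lemma antidiagonal_closed : closed_subgroup (@sub C P) K.
Proof.
have [e11 e22 e12 e21 e] := biproduct_split bip.
move=> x xK; have [|a' Kxa'] := pp1_lift (x := x).
  apply: eq0_osub => W oW; have [k Kk] := xK _ (osub_preimage (p \oc p1) oW).
  by rewrite /= fn_B (pp1K Kk) subr0.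
suff a'0 : a' = 0 by move: Kxa'; rewrite a'0 fn_0 subr0.
apply: eq0_osub => W oW; have [U oU UW] := antidiagonal_embedding oW.
apply: UW; rewrite -[fn i2 a'](subKr x); apply: (subgroup_sub_add _ sK).2 => //.
- exact: sG oU.1.
- exact: xK.
- exact/sub_addr/Kxa'/sG/oU.1.
Qed.

(** The sequence [0 -> A' -> P/K -> Q -> 0] makes [P/K] an extension of the
    complete groups [Q] and [A']: a Cauchy family modulo [K] is first moved
    into [A'], by subtracting a lift of its limit in [Q], and then has a limit
    in [A']. *)
Lemma antidiagonal_complete : complete_modulo (@sub C P) K.
Proof.
move=> c cc; set r := p \oc p1; have rop := antidiagonal_sum_open_epi.
have sS U : osub P U -> subgroup (sub_add U K).
  by move=> oU; apply: subgroup_sub_add => //; exact: sG oU.1.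
(* the limit [q] of the images in [Q], and a lift [x0] of it *)
have [W W' oW oW' W'W|q qE] := @osub_limit Q (fun W => fn r (c (fn r @^-1` W))).
  have [|k Kk] := cc _ _ (osub_preimage r oW) (osub_preimage r oW').
    by move=> x /=; exact: W'W.
  by rewrite /= !fn_B (pp1K Kk) subr0.
have [x0 x0q] := rop.1 q.
(* modulo [U + K], the family translated by [x0] is a family [d] in [A'] *)
have /choice[d dE] U : exists a' : car A', osub P U ->
    sub_add U K (c U - x0 - fn i2 a').
  have [oU|nU] := pselect (osub P U); last by exists 0.
  have oW := osub_image rop oU; set V := fn r @^-1` (fn r @` U).
  have [u Uu uE] : (fn r @` U) (fn r (c U - x0)).
    rewrite fn_B x0q; apply: (subgroupB_trans (sG oW.1)); last exact: qE.
    have UV : U `<=` V by move=> x Ux; exists x.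
    have [k Kk [u Uu uE]] := cc _ _ (osub_preimage r oW) oU UV.
    by exists u; rewrite ?uE // !fn_B (pp1K Kk) subr0.
  have [|a' Ka'] := pp1_lift (x := c U - x0 - u); first by rewrite fn_B uE subrr.
  exists a' => _; exists (c U - x0 - u - fn i2 a') => //.
  by rewrite [X in _ - X]addrAC subKr.
(* an open [W] in [A'] is controlled by an open [phi W] in [P], so that
   [d (phi W)] determines the limit up to [W] *)
have /choice[phi phiE] W : exists U, osub A' W ->
    osub P U /\ forall a', sub_add U K (fn i2 a') -> W a'.
  have [/antidiagonal_embedding[U oU UW]|nW] := pselect (osub A' W); last by exists setT.
  by exists U.
have dC W U V : osub A' W -> osub P U -> osub P V -> V `<=` U -> U `<=` phi W ->
    W (d V - d U).
  move=> oW oU oV VU UW; have [oF FW] := phiE W oW.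
  apply: FW; apply: (sub_add_mono UW); rewrite fn_B.
  apply: (subgroupB_trans (sS _ oU) (y := c V - x0)).
    by apply: (subgroupBC (sS _ oU)); apply: (sub_add_mono VU); exact: dE.
  apply: (subgroupB_trans (sS _ oU) (y := c U - x0)); last exact: dE.
  by rewrite opprB addrA subrK; exact: cc.
have [W W' oW oW' W'W|a' a'E] := @osub_limit A' (fun W => d (phi W)).
  have [oF _] := phiE _ oW; have [oF' _] := phiE _ oW'.
  have oV := osub_setI oF oF'.
  apply: (subgroupB_trans (sG oW.1) (y := d (phi W `&` phi W'))).
    apply: (subgroupBC (sG oW.1)); apply: W'W; exact: (dC W' (phi W')).
  exact: (dC W (phi W)).
exists (x0 + fn i2 a') => U oU; rewrite opprD addrA.
set W := fn i2 @^-1` U; have oW : osub A' W by exact: osub_preimage.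
have [oF _] := phiE _ oW; have oV := osub_setI oU oF.
have VU : U `&` phi W `<=` U by move=> x [].
apply: (subgroupB_trans (sS _ oU) (y := c (U `&` phi W) - x0)).
  rewrite opprB addrA subrK; apply: (subgroupBC (sS _ oU)); exact: cc.
apply: (subgroupB_trans (sS _ oU) (y := fn i2 (d (U `&` phi W)))).
  by apply: (sub_add_mono VU); exact: dE.
apply: (sub_addl sK); rewrite -fn_B.
apply: (subgroupB_trans (sG oW.1) (y := d (phi W))); last exact: a'E.
exact: (dC W (phi W)).
Qed.

(** [P/K] is the pushout, its map from [A'] is again an embedding with quotient
    [Q], and [B] maps onto it openly as soon as [A] maps openly onto [A']. *)
Lemma antidiagonal_quotient : exists B' (f' : hom A' B') (g' : hom B B'),
  [/\ is_pushout f g f' g', admissible_mono strict_exact f',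
      open_epi g -> open_epi g' &
      forall b, fn g' b = 0 <-> exists2 a, fn f a = b & fn g a = 0].
Proof.
have [e11 e22 e12 e21 e] := biproduct_split bip.
have sKK : sub K by exact/sub_image/sub_full.
have [B' [q [qop kq]]] :=
  quotient_object sKK antidiagonal_closed antidiagonal_complete.
have qU U b' : osub P U -> (fn q @` U) (fn q b') -> sub_add U K b'.
  move=> oU [u Uu ub']; exists (b' - u); last by rewrite subKr.
  by apply/kq; rewrite fn_B ub' subrr.
exists B', (q \oc i2), (q \oc i1).
have qi x : fn q x = fn (q \oc i1) (fn p1 x) + fn (q \oc i2) (fn p2 x).
  by rewrite !fnM -fn_D e.
have sq : (q \oc i1) \oc f = (q \oc i2) \oc g.
  apply: fn_inj => a; apply/eqP; rewrite -subr_eq0 !fnM -fn_B; apply/eqP/kq.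
  by exists a; rewrite // fnB !fnM.
split.
- split=> // T u v uv.
  have [x /kq[a _ <-]|w wE] := fn_descent (f := u \oc p1 + v \oc p2) qop.
    rewrite fnB fnD !fnM !fn_B e11 e12 e21 e22 !fn_0 subr0 sub0r.
    by rewrite -!fnM uv subrr.
  exists w; split=> [|w' [w'u w'v]].
    split; apply: fn_inj => x; rewrite !fnM wE fnD !fnM.
      by rewrite e11 e21 fn_0 addr0.
    by rewrite e12 e22 fn_0 add0r.
  apply: fn_inj => b'; have [x <-] := qop.1 b'.
  by rewrite wE qi fn_D -(fnM w' (q \oc i1)) -(fnM w' (q \oc i2)) w'u w'v fnD !fnM.
- have [x /kq/pp1K //|s sE] := fn_descent (f := p \oc p1) qop.
  exists Q, s; split=> /=.
  + move=> W oW; have [U oU UW] := antidiagonal_embedding oW.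
    exists (fn q @` U); first exact: osub_image.
    by move=> a' /=; rewrite fnM => /(qU _ _ oU)/UW.
  + apply: (open_epi_cancel (f := q)).
    have -> : s \oc q = p \oc p1 by apply: fn_inj => x; rewrite fnM sE.
    exact: antidiagonal_sum_open_epi.
  + move=> b'; have [x <-] := qop.1 b'; rewrite sE; split=> [/pp1_lift[a' Ka']|[a' a'x]].
      exists a'; rewrite fnM; apply/eqP; rewrite -subr_eq0 -fn_B; apply/eqP/kq.
      by rewrite -opprB; exact: subgroupN.
    rewrite -sE -a'x fnM sE fnM e12 fn_0 //.
- move=> [sg og]; split=> [b'|U oU].
    have [x <-] := qop.1 b'; have [a ax] := sg (fn p2 x).
    exists (fn p1 x + fn f a); rewrite qi fn_D; congr (_ + _).
    by rewrite -fnM sq fnM ax.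
  have [W oW WU] := og _ (osub_preimage f oU).
  exists (fn q @` (fn p1 @^-1` U `&` fn p2 @^-1` W)).
    by apply: osub_image => //; apply: osub_setI; exact: osub_preimage.
  move=> _ [x [/= Ux /WU[a /= Ua ax]] <-].
  exists (fn p1 x + fn f a); first exact: (subgroupD (sG oU.1)).
  by rewrite qi fn_D; congr (_ + _); rewrite -fnM sq fnM ax.
- move=> b; rewrite fnM; split=> [/kq/antidiagonalP[a []]|[a <- a0]].
    rewrite e11 e21 => ab /eqP; rewrite eq_sym oppr_eq0 => /eqP ga.
    by exists a.
  by apply/kq/antidiagonalP; exists a; rewrite e11 e21 a0 oppr0.
Qed.

End Antidiagonal.

Lemma strict_pushout A B A' (f : hom A B) (g : hom A A') :
  admissible_mono strict_exact f -> exists B' (f' : hom A' B') (g' : hom B B'),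
  [/\ is_pushout f g f' g', admissible_mono strict_exact f',
      open_epi g -> open_epi g' &
      forall b, fn g' b = 0 <-> exists2 a, fn f a = b & fn g a = 0].
Proof.
move=> [Q [p ex]]; have [P [i1 [i2 [p1 [p2 bip]]]]] := has_biproducts B A'.
exact: antidiagonal_quotient bip ex.
Qed.

(** The quotient of [D] by [A] is the pushout of [B -> D] along [B -> B/A]. *)
Lemma comp_admissible_mono A B D (f : hom A B) (g : hom B D) :
  admissible_mono strict_exact f -> admissible_mono strict_exact g ->
  admissible_mono strict_exact (g \oc f).
Proof.
move=> [Q [p [/= ef op kp]]] ag; have [R [r [/= eg _ _]]] := ag.
have [D' [g' [p' [_ _ op' kp']]]] := strict_pushout p ag.
exists D', p'; split=> /=; [exact: comp_embedding|exact: op'|].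
move=> d; rewrite kp'; split=> [[b <- /kp[a <-]]|[a <-]].
  by exists a; rewrite fnM.
by exists (fn f a); [rewrite fnM|apply/kp; exists a].
Qed.

Lemma strict_exact_structure : exact_structure strict_exact.
Proof.
split.
- by move=> S ex; split; [exact: strict_exact_kernel|exact: strict_exact_cokernel].
- exact: strict_exact_iso.
- exact: idm_admissible_mono.
- by move=> A; apply/admissible_epiP; exact: idm_open_epi.
- exact: comp_admissible_mono.
- move=> A B D f g /admissible_epiP of_ /admissible_epiP og.
  by apply/admissible_epiP; exact: comp_open_epi.
- move=> A B A' f g /(strict_pushout g)[B' [f' [g' [po af' _ _]]]].
  by exists B', f', g'.
- move=> B A' B' f' g' /admissible_epiP/(strict_pullback g')[A [f [g [pb of_]]]].
  by exists A, f, g; split=> //; apply/admissible_epiP.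
Qed.

(** ** Maximality *)

(** [A/M] is discrete, hence complete, for every open [M]. *)
Lemma discrete_quotient A (M : set (car A)) : osub A M ->
  exists T (t : hom A T), osub T [set 0] /\ forall x, fn t x = 0 <-> M x.
Proof.
move=> oM; have sM := sG oM.1.
have MM x : sub_add M M x -> M x.
  by move=> [m Mm /(subgroupD sM)]; move=> /(_ _ Mm); rewrite subrK.
have [|c cc|T [t [ot kt]]] := quotient_object oM.1.
- by move=> x /(_ _ oM)/MM.
- exists (c M) => U oU; have oV := osub_setI oU oM; have sU := sG oU.1.
  apply: (subgroupB_trans (subgroup_sub_add sU sM) (y := c (U `&` M))).
    by apply: (subgroupBC (subgroup_sub_add sU sM)); apply: cc => // x [].
  by apply: (sub_addr sU); apply: MM; apply: cc => // x [].
exists T, t; split=> //; have [V oV VM] := ot.2 _ oM.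
suff <- : V = [set 0] by [].
apply/seteqP; split=> [y /VM[x /kt tx <-] //|_ ->]; exact: osub0 oV.
Qed.

(** A cokernel is open onto its image: the cokernel of [K -> A] maps to the
    discrete quotient [A/(U + K)] for every open [U]. *)
Lemma cokernel_open K A B (i : hom K A) (p : hom A B) U :
  is_cokernel p i -> osub A U ->
  exists2 V, osub B V & forall x, V (fn p x) -> (fn p @` U) (fn p x).
Proof.
move=> [pi_0 cok] oU.
have oM : osub A (fn p @^-1` (fn p @` U)).
  apply: (osub_above _ oU); first exact/sub_preimage/sub_image/oU.1.
  by move=> x Ux; exists x.
have [T [t [oT kt]]] := discrete_quotient oM.
have [|g [gp _]] := cok T t.
  apply: fn_inj => x; rewrite fnM fn0; apply/kt => /=.
  by exists 0; [exact: osub0 oU|rewrite fn_0 -fnM pi_0 fn0].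
exists (fn g @^-1` [set 0]); first exact: osub_preimage.
by move=> x /=; rewrite -fnM gp => /kt.
Qed.

(** An epimorphism onto a discrete object is surjective; pulling an admissible
    epimorphism back to the discrete [point_object] along the morphism given by
    an element lifts this element. *)
Lemma exact_epi_surjective (E : short_seq C -> Prop) A B (p : hom A B) :
  exact_structure E -> admissible_epi E p -> forall b, exists a, fn p a = b.
Proof.
move=> ex ap b; have [Z [z [oZ /(_ B b)[f fz]]]] := point_object C.
have [P [q [h [[pb _] [K [i /(exact_ker_coker ex)[_ /= [_ cok]]]]]]]] :=
  exact_pullback ex f ap.
have oM : osub Z (fn q @` setT).
  apply: (osub_above _ oZ); first exact/sub_image/sub_full.
  by move=> _ ->; exists 0; rewrite ?fn_0.
have [T [t [_ kt]]] := discrete_quotient oM.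
have [|g [_ gU]] := cok T 0; first by apply: fn_inj => x; rewrite fnM !fn0.
have t0 : t = 0.
  rewrite -(gU t); last by apply: fn_inj => x; rewrite fnM fn0; apply/kt; exists x.
  by apply: gU; apply: fn_inj => x; rewrite fnM !fn0.
have [x _ xz] : (fn q @` setT) z by apply/kt; rewrite t0 fn0.
by exists (fn h x); rewrite -fnM -pb fnM xz.
Qed.

(** Any kernel of [p] is isomorphic to the set-theoretic one with the induced
    topology. *)
Lemma kernel_strict K A B (i : hom K A) (p : hom A B) : is_kernel i p ->
  embedding i /\ forall x, fn p x = 0 <-> exists y, fn i y = x.
Proof.
move=> [pi_0 ker].
have inj y : fn i y = 0 -> y = 0.
  have [L [j [_ kj]]] := kernel_object i; move=> /kj[x <-].
  have [|g [_ gU]] := ker L 0; first by apply: fn_inj => ?; rewrite fnM !fn0 fn_0.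
  have <- : g = j by apply: gU; apply: fn_inj => ?; rewrite fnM fn0; apply/kj; eexists.
  by rewrite (gU 0) ?fn0 //; apply: fn_inj => ?; rewrite fnM !fn0 fn_0.
have [L [j [ej kj]]] := kernel_object p.
have [|g [gE _]] := ker _ j.
  by apply: fn_inj => x; rewrite fnM fn0; apply/kj; exists x.
have kp x : fn p x = 0 <-> exists y, fn i y = x.
  split=> [/kj[y <-]|[y <-]]; first by exists (fn g y); rewrite -fnM gE.
  by rewrite -fnM pi_0 fn0.
split=> // U oU; have [V oV VU] := ej _ (osub_preimage g oU).
exists V => // y /= Vy; have /kj[x xy] : fn p (fn i y) = 0 by apply/kp; exists y.
have <- : fn g x = y; last by apply: VU; rewrite /= xy.
by apply/eqP; rewrite -subr_eq0; apply/eqP/inj; rewrite fn_B -fnM gE xy subrr.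
Qed.

Theorem strict_exact_maximal : maximal_exact_structure strict_exact.
Proof.
split; first exact: strict_exact_structure.
move=> E ex [K A B i p] ES; have [/= ker cok] := exact_ker_coker ex ES.
have [ei kp] := kernel_strict ker; split=> //=; split=> [|U oU].
  by apply: (exact_epi_surjective ex); exists K, i.
have [V oV VU] := cokernel_open cok oU; exists V => // b.
have [|a <-] := exact_epi_surjective ex (p := p) _ b; first by exists K, i.
exact: VU.
Qed.

End ExactStructure.

(** * Topologies given by a base of subgroups *)

Record subgroup_base (G : zmodType) := SubgroupBase {
  base_set : set (set G);
  base_subgroup : forall U, base_set U -> subgroup U;
  base_setI : forall U V, base_set U -> base_set V ->
    exists2 W, base_set W & W `<=` U `&` V;
  base_nonempty : base_set !=set0 }.

(** The base is part of the type, since the same group carries different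
    topologies. *)
Definition lintop (G : zmodType) (B : subgroup_base G) : Type := G.

HB.instance Definition _ (G : zmodType) (B : subgroup_base G) :=
  GRing.Zmodule.on (lintop B).
HB.instance Definition _ (k : fieldType) (G : lmodType k) (B : subgroup_base G) :=
  GRing.Lmodule.copy (lintop B) G.

Section LinTop.
Variables (G : zmodType) (B : subgroup_base G).
Local Notation T := (lintop B).

Definition lintop_nbhs (x : T) : set_system T :=
  filter_from (base_set B) (fun U => [set y : T | U (y - x)]).

HB.instance Definition _ := hasNbhs.Build T lintop_nbhs.

Let nbhs_filter (x : T) : ProperFilter (nbhs x).
Proof.
apply: filter_from_proper => [|U BU]; last first.
  by exists x; rewrite /= subrr; exact: (base_subgroup BU).1.
apply: filter_from_filter => [|U V BU BV]; first exact: base_nonempty.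
by have [W BW WUV] := base_setI BU BV; exists W => // y /= /WUV[].
Qed.

Let nbhs_singleton' (x : T) (P : set T) : nbhs x P -> P x.
Proof. by case=> U BU; apply; rewrite /= subrr; exact: (base_subgroup BU).1. Qed.

Let nbhs_nbhs (x : T) (P : set T) : nbhs x P -> nbhs x (nbhs^~ P).
Proof.
case=> U BU UP; exists U => // y /= Uyx; exists U => // z /= Uzy; apply: UP => /=.
exact: (subgroupB_trans (base_subgroup BU) (y := y)).
Qed.

HB.instance Definition _ := Nbhs_isNbhsTopological.Build T
  nbhs_filter nbhs_singleton' nbhs_nbhs.

Let sub_continuous : continuous (fun x : T * T => x.1 - x.2).
Proof.
move=> [x y] P [U BU UP] /=.
exists ([set z : T | U (z - x)], [set z : T | U (z - y)]).
  by split; exists U.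
move=> [x' y'] /= [Ux Uy]; apply: UP => /=.
have -> : x' - y' - (x - y) = (x' - x) - (y' - y).
  by rewrite !opprB addrACA [RHS]addrACA [- y' + _]addrC.
exact: (base_subgroup BU).2.
Qed.

HB.instance Definition _ :=
  PreTopologicalNmodule_isTopologicalZmodule.Build T sub_continuous.

Lemma lintop_open (U : set T) : base_set B U -> open U.
Proof.
move=> BU; rewrite openE => x Ux; exists U => // y /= Uyx.
by rewrite -(subrK x y); exact: (subgroupD (base_subgroup BU)).
Qed.

Lemma lintop_base_below (P : set T) : nbhs (0 : T) P ->
  exists2 U, base_set B U & U `<=` P.
Proof. by case=> U BU UP; exists U => // y Uy; apply: UP; rewrite /= subr0. Qed.

Definition base_complete : Prop := forall c : set G -> G,
  (forall U V, base_set B U -> base_set B V -> V `<=` U -> U (c V - c U)) ->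
  exists a, forall U, base_set B U -> U (c U - a).

Lemma lintop_sc (sub : set (set T)) :
  (forall U, sub U -> subgroup U) -> (forall U, base_set B U -> sub U) ->
  (forall x : G, (forall U, base_set B U -> U x) -> x = 0) -> base_complete ->
  sc_topology sub.
Proof.
move=> subG Bsub sep com.
have oB (U : set T) : base_set B U -> open_sub sub U.
  by move=> BU; split; [exact: Bsub|exact: lintop_open].
split.
- by move=> P /lintop_base_below[U BU UP]; exists U => //; exact: oB.
- move=> a b ab; apply/eqP; rewrite -subr_eq0; apply/eqP/sep => U BU.
  by apply/(cosetE a b (base_subgroup BU)); exact: ab (oB _ BU).
apply: complete_from_base => // c [cE cS].
have /choice[r rE] U : exists a, open_sub sub U -> c U = coset U a.
  have [/cE[a cU]|nU] := pselect (open_sub sub U); last by exists 0.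
  by exists a.
have crr U : open_sub sub U -> c U (r U).
  by move=> oU; rewrite rE //; apply: coset_refl; exact: subG oU.1.
have [U V BU BV VU|a aE] := com r.
  suff : c U (r V) by rewrite rE; last exact: oB.
  by apply: cS VU _ (crr _ _); exact: oB.
exists a => W oW.
have [U BU UW] := lintop_base_below (open_sub_nbhs subG oW).
exists U; split=> //; first exact: oB.
rewrite rE; last exact: oB.
by apply: (subgroupBC (base_subgroup BU)); exact: aE.
Qed.

End LinTop.

Section LinTopVect.
Variables (k : fieldType) (G : lmodType k) (B : subgroup_base G).
Hypothesis Bsub : forall U, base_set B U -> subspace U.
Local Notation T := (lintop B).

Let vscale_continuous :
  continuous (fun z : discrete_topology k * T => (z.1 : k) *: z.2).
Proof.
move=> [a x] P [U BU UP] /=.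
exists ([set a], [set y : T | U (y - x)]).
  split; first by rewrite /= nbhs_principalE; exact/principal_filterP.
  by exists U.
move=> [b y] /= [-> Uyx]; apply: UP => /=.
have := (Bsub BU).2 a (y - x) 0 Uyx (Bsub BU).1.
by rewrite addr0 scalerBr.
Qed.

Definition lintop_vect : topologicalVect k :=
  topologicalVect_of k T vscale_continuous.

Lemma lintop_subspace_subgroup (U : set lintop_vect) : subspace U -> @subgroup T U.
Proof. exact: (@subspace_subgroup k lintop_vect). Qed.

Lemma lintop_vect_sc :
  (forall x : G, (forall U, base_set B U -> U x) -> x = 0) -> base_complete B ->
  sc_topology (@subspace k lintop_vect).
Proof. by apply: lintop_sc; [exact: lintop_subspace_subgroup|exact: Bsub]. Qed.
End LinTopVect.

(** * Kernels and quotients *)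

Section SubgroupPred.
Variables (G : zmodType) (U : set G).
Definition subgroup_pred of subgroup U : {pred G} := mem U.
Hypothesis sU : subgroup U.
Lemma subgroup_pred_closed : zmod_closed (subgroup_pred sU).
Proof. by split=> [|x y]; rewrite !inE; [exact: sU.1|exact: sU.2]. Qed.
HB.instance Definition _ :=
  GRing.isZmodClosed.Build G (subgroup_pred sU) subgroup_pred_closed.
End SubgroupPred.

Section SubspacePred.
Variables (k : fieldType) (G : lmodType k) (U : set G).
Definition subspace_pred of subspace U : {pred G} := mem U.
Hypothesis sU : subspace U.
HB.instance Definition _ := GRing.isZmodClosed.Build G (subspace_pred sU)
  (subgroup_pred_closed (subspace_subgroup sU)).
Let closed : submod_closed (subspace_pred sU).
Proof. by split=> [|a x y]; rewrite !inE; [exact: sU.1|exact: sU.2]. Qed.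
HB.instance Definition _ :=
  GRing.isSubmodClosed.Build k G (subspace_pred sU) closed.
End SubspacePred.

Section SubgroupType.
Variables (G : zmodType) (I : zmodClosed G).
Record subgroup_type := SubgroupElt { elt : G; eltP : elt \in I }.
HB.instance Definition _ := [isSub for elt].
HB.instance Definition _ := [Choice of subgroup_type by <:].
HB.instance Definition _ := [SubChoice_isSubZmodule of subgroup_type by <:].

Lemma elt_zmod : zmod_morphism elt.
Proof. exact: (raddfB (\val : subgroup_type -> G)). Qed.
End SubgroupType.

Section SubspaceType.
Variables (k : fieldType) (G : lmodType k) (U : set G) (sU : subspace U).
HB.instance Definition _ :=
  [SubZmodule_isSubLmodule of subgroup_type (subspace_pred sU) by <:].
End SubspaceType.

Section QuotientGroup.
Variables (G : zmodType) (I : zmodClosed G).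
Local Notation Q := (Quotient.quot I).
Lemma quot_pi_zmod : zmod_morphism (\pi_Q : G -> Q).
Proof. exact: raddfB. Qed.

Lemma quot_piD x y : \pi_Q (x + y) = \pi_Q x + \pi_Q y.
Proof. exact: raddfD. Qed.

Lemma quot_pi_eq0 x : \pi_Q x = 0 <-> x \in I.
Proof.
rewrite -[x in x \in I]subr0 Quotient.idealrBE (raddf0 \pi_Q).
by split=> [->|/eqP].
Qed.
End QuotientGroup.

Section QuotientSpace.
Variables (k : fieldType) (G : lmodType k) (U : set G) (sU : subspace U).
Local Notation Q := (Quotient.quot (subspace_pred sU)).
Definition quot_scale (a : k) (x : Q) : Q := \pi_Q (a *: repr x).
Lemma pi_scale a x : quot_scale a (\pi_Q x) = \pi_Q (a *: x).
Proof.
apply/eqP; rewrite /quot_scale -Quotient.idealrBE -scalerBr rpredZ //.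
by rewrite Quotient.idealrBE reprK.
Qed.
Let scaleA a b v : quot_scale a (quot_scale b v) = quot_scale (a * b) v.
Proof. by rewrite -[v]reprK (pi_scale b) !pi_scale scalerA. Qed.
Let scale1 : left_id 1 quot_scale.
Proof. by move=> v; rewrite -[v]reprK pi_scale scale1r. Qed.
Let scaleDr : right_distributive quot_scale +%R.
Proof.
move=> a u v; rewrite -[u]reprK -[v]reprK -quot_piD !pi_scale -quot_piD.
by rewrite scalerDr.
Qed.
Let scaleDl v : {morph quot_scale^~ v : a b / a + b}.
Proof. by move=> a b; rewrite -[v]reprK !pi_scale -quot_piD scalerDl. Qed.
HB.instance Definition _ :=
  GRing.Zmodule_isLmodule.Build k Q scaleA scale1 scaleDr scaleDl.
End QuotientSpace.

Section SubgroupsOfMorphisms.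
Variables (A B : zmodType) (f : A -> B).
Hypothesis fB : zmod_morphism f.

Lemma subgroup_preimage V : subgroup V -> subgroup (f @^-1` V).
Proof.
move=> [V0 VB]; split=> [|x y /= Vx Vy]; first by rewrite /= (zmod_morphism0 fB).
by rewrite fB; exact: VB.
Qed.

Lemma subgroup_image U : subgroup U -> subgroup (f @` U).
Proof.
move=> [U0 UB]; split=> [|_ _ [x Ux <-] [y Uy <-]].
  by exists 0; rewrite ?(zmod_morphism0 fB).
by exists (x - y); [exact: UB|exact: fB].
Qed.

Lemma subgroup_setI (U V : set A) : subgroup U -> subgroup V -> subgroup (U `&` V).
Proof.
by move=> [U0 UB] [V0 VB]; split=> // x y [Ux Vx] [Uy Vy]; split; [exact: UB|exact: VB].
Qed.

Lemma subgroup0 : subgroup [set 0 : A].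
Proof. by split=> // x y -> ->; rewrite /= subrr. Qed.
End SubgroupsOfMorphisms.

Section SubspacesOfMorphisms.
Variables (k : fieldType) (A B : lmodType k) (f : A -> B).
Hypothesis fL : linear f.

Let f0 : f 0 = 0.
Proof. by have := fL (-1) 0 0; rewrite !scaleN1r oppr0 addr0 addNr. Qed.

Lemma subspace_preimage V : subspace V -> subspace (f @^-1` V).
Proof.
move=> [V0 VL]; split=> [|a x y /= Vx Vy]; first by rewrite /= f0.
by rewrite fL; exact: VL.
Qed.

Lemma subspace_image U : subspace U -> subspace (f @` U).
Proof.
move=> [U0 UL]; split=> [|a _ _ [x Ux <-] [y Uy <-]]; first by exists 0.
by exists (a *: x + y); [exact: UL|exact: fL].
Qed.

Lemma subspace_setI (U V : set A) : subspace U -> subspace V -> subspace (U `&` V).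
Proof.
by move=> [U0 UL] [V0 VL]; split=> // a x y [Ux Vx] [Uy Vy]; split; [exact: UL|exact: VL].
Qed.

Lemma subspace0 : subspace [set 0 : A].
Proof. by split=> // a x y -> ->; rewrite /= scaler0 addr0. Qed.
End SubspacesOfMorphisms.

Section InducedTopology.
Variables (A : topologicalZmodType) (sub : set (set A)) (I : zmodClosed A).
Hypotheses (sub_group : forall U, sub U -> subgroup U)
  (subI : forall U V, sub U -> sub V -> sub (U `&` V))
  (sc : sc_topology sub).

Local Notation S := (subgroup_type I).

Lemma open_subI U V : open_sub sub U -> open_sub sub V -> open_sub sub (U `&` V).
Proof. by move=> [? ?] [? ?]; split; [exact: subI|exact: openI]. Qed.

Lemma exists_open_sub : exists U, open_sub sub U.
Proof. by have [lin _ _] := sc; have [U oU _] := lin setT filterT; exists U. Qed.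

Program Definition induced_base : subgroup_base S := @SubgroupBase S
  [set W | exists2 U, open_sub sub U & W = @elt _ I @^-1` U] _ _ _.
Next Obligation.
by move=> _ [V oV ->]; apply: subgroup_preimage; [exact: elt_zmod|exact: sub_group oV.1].
Qed.
Next Obligation.
move=> _ _ [U' oU ->] [V' oV ->]; exists (@elt _ I @^-1` (U' `&` V')) => //.
by exists (U' `&` V') => //; exact: open_subI.
Qed.
Next Obligation.
by have [U oU] := exists_open_sub; exists (@elt _ I @^-1` U), U.
Qed.

Local Notation T := (lintop induced_base).

Lemma induced_continuous : continuous (@elt _ I : T -> A).
Proof.
have [lin _ _] := sc.
apply: (@morphism_continuous T A (base_set induced_base) sub _ (@elt_zmod A I) _ lin).
  by move=> U; exact: base_subgroup.
move=> V oV; have BV : base_set induced_base (@elt _ I @^-1` V) by exists V.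
by exists (@elt _ I @^-1` V) => //; split=> //; exact: (lintop_open (B := induced_base)).
Qed.

Variable subT : set (set T).
Hypotheses (subT_group : forall U, subT U -> subgroup U)
  (base_subT : forall U, base_set induced_base U -> subT U).

Lemma induced_embedding : linear_embedding subT sub (@elt _ I : T -> A).
Proof.
move=> U oU; have [_ [V oV ->] VU] := lintop_base_below (open_sub_nbhs subT_group oU).
by exists V.
Qed.

(** A Cauchy family in a subgroup has a limit in [A], which lies in the
    closure of the subgroup. *)
Lemma induced_sc : closed_subgroup sub [set x | x \in I] -> sc_topology subT.
Proof.
move=> Icl; have [_ sep com] := sc; apply: lintop_sc => //.
  move=> x x0; apply: val_inj; apply: (sepP sub_group sep) => U oU.
  by have := x0 (@elt _ I @^-1` U); apply; exists U.
move=> c cc; have [U V oU oV VU|a aE] :=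
  complete_limit sub_group (c := fun U => elt (c (@elt _ I @^-1` U))) com.
  rewrite -elt_zmod; apply: (cc (@elt _ I @^-1` U) (@elt _ I @^-1` V)).
  - by exists U.
  - by exists V.
  - by move=> x /=; exact: VU.
have Ia : a \in I.
  apply: Icl => U oU; exists (elt (c (@elt _ I @^-1` U))); first exact: eltP.
  by apply: (subgroupBC (sub_group oU.1)); exact: aE.
by exists (SubgroupElt Ia) => _ [U oU ->]; exact: aE.
Qed.
End InducedTopology.

Section QuotientTopology.
Variables (A : topologicalZmodType) (sub : set (set A)) (I : zmodClosed A).
Hypotheses (sub_group : forall U, sub U -> subgroup U)
  (subI : forall U V, sub U -> sub V -> sub (U `&` V))
  (sc : sc_topology sub).

Local Notation Q := (Quotient.quot I).
Local Notation pi := (\pi_Q : A -> Q).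

Program Definition quotient_base : subgroup_base Q := @SubgroupBase Q
  [set W | exists2 U, open_sub sub U & W = pi @` U] _ _ _.
Next Obligation.
by move=> _ [V oV ->]; apply: subgroup_image; [exact: quot_pi_zmod|exact: sub_group oV.1].
Qed.
Next Obligation.
move=> _ _ [U' oU ->] [V' oV ->]; exists (pi @` (U' `&` V')).
  by exists (U' `&` V') => //; exact: open_subI.
by move=> _ [x [Ux Vx] <-]; split; exists x.
Qed.
Next Obligation.
by have [U oU] := exists_open_sub sc; exists (pi @` U), U.
Qed.

Local Notation T := (lintop quotient_base).

Lemma quot_pi_image U x : (pi @` U) (\pi_Q x) <-> sub_add U [set x | x \in I] x.
Proof.
split=> [[u Uu ux]|[k /= Ik Uxk]].
  exists (x - u); last by rewrite subKr.
  by apply/quot_pi_eq0; rewrite quot_pi_zmod ux subrr.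
by exists (x - k) => //; rewrite quot_pi_zmod (quot_pi_eq0 I k).2 // subr0.
Qed.

Variable subT : set (set T).
Hypotheses (subT_group : forall U, subT U -> subgroup U)
  (base_subT : forall U, base_set quotient_base U -> subT U).

Lemma quotient_open_surjection : open_surjection sub subT (pi : A -> T).
Proof.
split=> [y|U oU]; first by exists (repr y); exact: reprK.
exists (pi @` U) => //; have BU : base_set quotient_base (pi @` U) by exists U.
by split; [exact: base_subT|exact: lintop_open].
Qed.

Lemma quotient_continuous : continuous (pi : A -> T).
Proof.
apply: (@morphism_continuous A T sub (base_set quotient_base) pi) => //.
- exact: quot_pi_zmod.
- move=> P /lintop_base_below[U BU UP]; exists U => //; split=> //.
  exact: lintop_open.
- by move=> _ [[U oU ->] _]; exists U => // x Ux; exists x.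
Qed.

Lemma quotient_sc : closed_subgroup sub [set x | x \in I] ->
  complete_modulo sub [set x | x \in I] -> sc_topology subT.
Proof.
move=> Icl Icom; apply: lintop_sc => // [y y0|c cc].
  rewrite -[y]reprK; apply/quot_pi_eq0; apply: Icl => U oU.
  by apply/quot_pi_image; rewrite reprK; apply: y0; exists U.
have [U V oU oV VU|a aE] := Icom (fun U => repr (c (pi @` U))).
  apply/quot_pi_image; rewrite quot_pi_zmod !reprK.
  by apply: cc; [exists U|exists V|move=> _ [x Vx <-]; exists x => //; exact: VU].
exists (\pi_Q a) => _ [U oU ->].
by rewrite -[c _]reprK -quot_pi_zmod; apply/quot_pi_image; exact: aE.
Qed.
End QuotientTopology.

Section Factorizations.
Variables A B D : topologicalZmodType.
Variables (subA : set (set A)) (subB : set (set B)) (subD : set (set D)).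
Hypotheses (subA_group : forall U, subA U -> subgroup U)
  (subB_group : forall U, subB U -> subgroup U)
  (subD_group : forall U, subD U -> subgroup U).

Lemma lift_embedding (i : A -> B) (f : D -> B) : sc_topology subA ->
  zmod_morphism i -> zmod_morphism f -> linear_embedding subA subB i ->
  (forall U, open_sub subB U -> open_sub subD (f @^-1` U)) ->
  (forall d, exists a, i a = f d) ->
  exists g : D -> A,
    [/\ forall d, i (g d) = f d, zmod_morphism g & continuous g].
Proof.
move=> [lin sep _] iB fB emb fc /choice[g gE].
have gB : zmod_morphism g.
  move=> x y; apply: (embedding_inj iB subA_group subB_group sep emb).
  by rewrite iB !gE fB.
exists g; split=> //; apply: (morphism_continuous gB subD_group lin) => V oV.
have [W oW WV] := emb V oV; exists (f @^-1` W); first exact: fc.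
by move=> d /=; rewrite -gE; exact: WV.
Qed.

Lemma descend_open (p : A -> B) (f : A -> D) : linear_topology subD ->
  zmod_morphism p -> zmod_morphism f -> open_surjection subA subB p ->
  (forall U, open_sub subD U -> open_sub subA (f @^-1` U)) ->
  (forall a, p a = 0 -> f a = 0) ->
  exists g : B -> D,
    [/\ forall a, g (p a) = f a, zmod_morphism g & continuous g].
Proof.
move=> lin pB fB [/choice[s sE] op] fc f0; pose g b := f (s b).
have gE a : g (p a) = f a.
  by apply/eqP; rewrite -subr_eq0 -fB; apply/eqP/f0; rewrite pB sE subrr.
have gB : zmod_morphism g by move=> x y; rewrite -[x]sE -[y]sE -pB !gE fB.
exists g; split=> //; apply: (morphism_continuous gB subB_group lin) => V oV.
have [W oW WV] := op _ (fc _ oV); exists W => // b /WV[a Va <-].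
by rewrite /= gE.
Qed.
End Factorizations.

Section DiscreteTopology.
Variable G : zmodType.
Program Definition discrete_base : subgroup_base G :=
  @SubgroupBase G [set [set 0]] _ _ _.
Next Obligation. by move=> _ ->; exact: subgroup0. Qed.
Next Obligation. by move=> _ _ -> ->; exists [set 0]; rewrite ?setIid. Qed.
Next Obligation. by exists [set 0]. Qed.

Local Notation T := (lintop discrete_base).

Lemma discrete_sc (sub : set (set T)) : (forall U, sub U -> subgroup U) ->
  sub [set 0] -> sc_topology sub.
Proof.
move=> subG sub0; apply: lintop_sc => //; first by move=> U ->.
  by move=> x /(_ [set 0] erefl).
by move=> c _; exists (c [set 0]) => _ ->; rewrite /= subrr.
Qed.

Lemma discrete_continuous (A : topologicalZmodType) (f : T -> A) :
  zmod_morphism f -> continuous f.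
Proof.
move=> fB x P Px; exists [set 0] => // y /= /eqP.
by rewrite subr_eq0 => /eqP ->; exact: nbhs_singleton.
Qed.
End DiscreteTopology.

(** * The categories of groups and of vector spaces *)

Lemma open_sub_comp (A B : topologicalZmodType) (subA : set (set A))
    (subB : set (set B)) (f : A -> B) : continuous f ->
  (forall U, subB U -> subA (f @^-1` U)) ->
  forall U, open_sub subB U -> open_sub subA (f @^-1` U).
Proof.
move=> fc fs U [sU oU]; split; first exact: fs.
by apply: open_comp => // x _; exact: fc.
Qed.

Lemma kernel_closed (A B : topologicalZmodType) (subA : set (set A))
    (subB : set (set B)) (f : A -> B) : (forall U, subB U -> subgroup U) ->
  separated_topology subB -> zmod_morphism f ->
  (forall U, open_sub subB U -> open_sub subA (f @^-1` U)) ->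
  closed_subgroup subA [set x | x \in (f @^-1` [set 0] : set A)].
Proof.
move=> sB sep fB fc a fa; rewrite /= inE; apply: (sepP sB sep) => U oU.
have [k] := fa _ (fc _ oU); rewrite /= inE => fk.
by rewrite fB [f k]fk subr0.
Qed.

Section Groups.
Implicit Types A B D K : topsc_group.

Lemma group_lift K A D (i : cont_hom K A) (f : cont_hom D A) :
  linear_embedding (@subgroup K) (@subgroup A) i ->
  (forall t, exists x, i x = f t) -> exists g : cont_hom D K, forall t, i (g t) = f t.
Proof.
move=> ei fi.
have [g [gE gB gc]] := lift_embedding (subA := @subgroup K) (subB := @subgroup A)
  (subD := @subgroup D) (fun _ => id) (fun _ => id) (fun _ => id) (tg_sc K)
  (cont_homB i) (cont_homB f) ei
  (open_sub_comp (@cont_hom_continuous _ _ f) (subgroup_preimage (cont_homB f))) fi.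
by exists (mk_cont_hom gB gc).
Qed.

Lemma group_descent A B D (p : cont_hom A B) (f : cont_hom A D) :
  open_surjection (@subgroup A) (@subgroup B) p ->
  (forall x, p x = 0 -> f x = 0) ->
  exists g : cont_hom B D, forall x, g (p x) = f x.
Proof.
have [lin _ _] := tg_sc D; move=> op fp.
have [g [gE gB gc]] := descend_open (subA := @subgroup A) (subB := @subgroup B)
  (subD := @subgroup D) (fun _ => id) lin
  (cont_homB p) (cont_homB f) op
  (open_sub_comp (@cont_hom_continuous _ _ f) (subgroup_preimage (cont_homB f))) fp.
by exists (mk_cont_hom gB gc).
Qed.

Lemma group_kernel A B (f : cont_hom A B) :
  exists (K : topsc_group) (i : cont_hom K A),
  linear_embedding (@subgroup K) (@subgroup A) i /\
  forall x, f x = 0 <-> exists y, i y = x.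
Proof.
have sk : subgroup (f @^-1` [set 0]).
  exact: (subgroup_preimage (cont_homB f) (subgroup0 B)).
have [_ sep _] := tg_sc B.
have cl := kernel_closed (fun _ => id) sep (cont_homB f)
  (open_sub_comp (@cont_hom_continuous _ _ f) (subgroup_preimage (cont_homB f))).
pose I : zmodClosed A := subgroup_pred sk.
pose bK := @induced_base A (@subgroup A) I (fun _ => id) (@subgroup_setI A) (tg_sc A).
have scK : sc_topology (@subgroup (lintop bK)).
  by apply: induced_sc => // U; exact: base_subgroup.
exists (TopscGroup scK).
exists (mk_cont_hom (@elt_zmod _ I : zmod_morphism (_ : lintop bK -> A))
  (@induced_continuous _ _ I _ _ _)).
split; first by apply: induced_embedding => // U; exact: base_subgroup.
move=> x; split=> [fx|[y <-]]; last by have := eltP y; rewrite inE.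
have Ix : x \in I by rewrite inE.
by exists (SubgroupElt Ix).
Qed.

Lemma group_quotient A (K : set A) : subgroup K ->
  closed_subgroup (@subgroup A) K -> complete_modulo (@subgroup A) K ->
  exists (Q : topsc_group) (q : cont_hom A Q),
    open_surjection (@subgroup A) (@subgroup Q) q /\ forall x, q x = 0 <-> K x.
Proof.
move=> sK; pose I : zmodClosed A := subgroup_pred sK.
have -> : K = [set x | x \in I] by apply/seteqP; split=> x /=; rewrite inE.
move=> cl com.
pose bQ := @quotient_base A (@subgroup A) I (fun _ => id) (@subgroup_setI A) (tg_sc A).
have scQ : sc_topology (@subgroup (lintop bQ)).
  by apply: quotient_sc => // U; exact: base_subgroup.
exists (TopscGroup scQ).
exists (mk_cont_hom (quot_pi_zmod I : zmod_morphism (_ : A -> lintop bQ))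
  (@quotient_continuous _ _ I _ _ _)).
split; first by apply: quotient_open_surjection => // U; exact: base_subgroup.
by move=> x; exact: quot_pi_eq0.
Qed.

Lemma group_point : exists (Z : topsc_group) (z : Z),
  open_sub (@subgroup Z) [set 0] /\
  forall A (a : A), exists f : cont_hom Z A, f z = a.
Proof.
have scZ : sc_topology (@subgroup (lintop (discrete_base int))).
  by apply: discrete_sc => //; exact: subgroup0.
exists (TopscGroup scZ), 1; split.
  by split; [exact: subgroup0|exact: lintop_open].
move=> A a.
have fB : zmod_morphism (fun n : lintop (discrete_base int) => a *~ n).
  by move=> m n; exact: mulrzBr.
by exists (mk_cont_hom fB (discrete_continuous fB)); exact: mulr1z.
Qed.

Program Definition group_category : linear_category :=
  @LinearCategory Topsc_group tg_sort (fun A => @subgroup A)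
    (fun A B => @cont_fun A B) (fun _ _ => id) tg_sc (fun A => subgroup0 A)
    (fun A => @subgroup_setI A) _ _ _ _ _ _ _ _ group_lift group_descent
    group_kernel group_quotient group_point.
Next Obligation. by move=> A B f U; exact: subgroup_preimage (cont_homB f) _. Qed.
Next Obligation. by move=> A B f U; exact: subgroup_image (cont_homB f) _. Qed.
Next Obligation. by move=> A B f g; exact: cont_homP. Qed.
Next Obligation. by []. Qed.
Next Obligation. by []. Qed.
Next Obligation. by []. Qed.
Next Obligation. by move=> A B f; exact: cont_homB. Qed.
Next Obligation. by move=> A B f; exact: cont_hom_continuous. Qed.
End Groups.

Section Vects.
Variable k : fieldType.
Implicit Types A B D K : topsc_vect k.
Local Notation sub_osub f := (open_sub_comp (@cont_linear_hom_continuous _ _ _ f)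
  (subspace_preimage (cont_linear_homL f))).

Let sG (A : topologicalVect k) := @subspace_subgroup k A.

Lemma vect_lift K A D (i : cont_linear_hom K A) (f : cont_linear_hom D A) :
  linear_embedding (@subspace k K) (@subspace k A) i ->
  (forall t, exists x, i x = f t) ->
  exists g : cont_linear_hom D K, forall t, i (g t) = f t.
Proof.
move=> ei fi; have [_ sep _] := tv_sc K.
have [g [gE _ gc]] := lift_embedding (@sG K) (@sG A) (@sG D) (tv_sc K)
  (cont_linear_homB i) (cont_linear_homB f) ei (sub_osub f) fi.
have gL : linear g.
  move=> a x y; apply: (embedding_inj (cont_linear_homB i) (@sG K) (@sG A) sep ei).
  by rewrite gE (cont_linear_homL f) (cont_linear_homL i) !gE.
by exists (mk_cont_linear gL gc).
Qed.

Lemma vect_descent A B D (p : cont_linear_hom A B) (f : cont_linear_hom A D) :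
  open_surjection (@subspace k A) (@subspace k B) p ->
  (forall x, p x = 0 -> f x = 0) ->
  exists g : cont_linear_hom B D, forall x, g (p x) = f x.
Proof.
have [lin _ _] := tv_sc D; move=> op fp.
have [g [gE _ gc]] := descend_open (@sG B) lin
  (cont_linear_homB p) (cont_linear_homB f) op (sub_osub f) fp.
have gL : linear g.
  move=> a x y.
  have [[x' <-] [y' <-]] := (op.1 x, op.1 y).
  by rewrite -(cont_linear_homL p) !gE (cont_linear_homL f).
by exists (mk_cont_linear gL gc).
Qed.

Lemma vect_kernel A B (f : cont_linear_hom A B) :
  exists (K : topsc_vect k) (i : cont_linear_hom K A),
  linear_embedding (@subspace k K) (@subspace k A) i /\
  forall x, f x = 0 <-> exists y, i y = x.
Proof.
have sk : subspace (f @^-1` [set 0]).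
  exact: (subspace_preimage (cont_linear_homL f) (subspace0 B)).
have [_ sep _] := tv_sc B.
have cl := kernel_closed (@sG B) sep (cont_linear_homB f) (sub_osub f).
pose I := subspace_pred sk.
pose bK := @induced_base A (@subspace k A) I (@sG A) (@subspace_setI k A) (tv_sc A).
have eltL : linear (@elt A I) by [].
have bS U : base_set bK U -> subspace U.
  by move=> [V [sV _] ->]; exact: (subspace_preimage eltL).
have scK : sc_topology (@subspace k (lintop_vect bS)).
  by apply: induced_sc => //; exact: (@sG (lintop_vect bS)).
exists (TopscVect scK).
exists (mk_cont_linear (eltL : linear (_ : lintop_vect bS -> A))
  (@induced_continuous _ _ _ _ _ _)).
split; first by apply: induced_embedding => //; exact: (@sG (lintop_vect bS)).
move=> x; split=> [fx|[y <-]]; last by have := eltP y; rewrite inE.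
have Ix : x \in I by rewrite inE.
by exists (SubgroupElt Ix).
Qed.

Lemma vect_quotient A (K : set A) : subspace K ->
  closed_subgroup (@subspace k A) K -> complete_modulo (@subspace k A) K ->
  exists (Q : topsc_vect k) (q : cont_linear_hom A Q),
    open_surjection (@subspace k A) (@subspace k Q) q /\
    forall x, q x = 0 <-> K x.
Proof.
move=> sK; pose I := subspace_pred sK.
have -> : K = [set x | x \in I] by apply/seteqP; split=> x /=; rewrite inE.
move=> cl com.
pose bQ := @quotient_base A (@subspace k A) I (@sG A) (@subspace_setI k A) (tv_sc A).
have piL : linear (\pi_(Quotient.quot I) : A -> Quotient.quot I).
  by move=> a x y; rewrite quot_piD -pi_scale.
have bS U : base_set bQ U -> subspace U.
  by move=> [V [sV _] ->]; exact: (subspace_image piL).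
have scQ : sc_topology (@subspace k (lintop_vect bS)).
  by apply: quotient_sc => //; exact: (@sG (lintop_vect bS)).
exists (TopscVect scQ), (mk_cont_linear (piL : linear (_ : A -> lintop_vect bS))
  (@quotient_continuous _ _ _ _ _ _)).
split; first by apply: quotient_open_surjection => //; exact: (@sG (lintop_vect bS)).
by move=> x; exact: quot_pi_eq0.
Qed.

Lemma vect_point : exists (Z : topsc_vect k) (z : Z),
  open_sub (@subspace k Z) [set 0] /\
  forall A (a : A), exists f : cont_linear_hom Z A, f z = a.
Proof.
have bS U : base_set (discrete_base k^o) U -> subspace U.
  by move=> ->; exact: subspace0.
have scZ : sc_topology (@subspace k (lintop_vect bS)).
  by apply: discrete_sc => //; [exact: (@sG (lintop_vect bS))|exact: (subspace0 k^o)].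
exists (TopscVect scZ), (1 : k^o); split.
  by split; [exact: subspace0|exact: lintop_open].
move=> A a.
have fL : linear (fun c : lintop_vect bS => (c : k) *: a).
  by move=> b x y; rewrite scalerDl scalerA.
have fB : zmod_morphism (fun c : lintop (discrete_base k^o) => (c : k) *: a).
  by move=> x y; rewrite scalerBl.
by exists (mk_cont_linear fL (discrete_continuous fB)); exact: scale1r.
Qed.

Program Definition vect_category : linear_category :=
  @LinearCategory (Topsc_vect k) (fun A => tv_sort A) (fun A => @subspace k A)
    (fun A B => @cont_linear_fun k A B) (fun A => @sG A) (@tv_sc k)
    (fun A => @subspace0 k A)
    (fun A => @subspace_setI k A) _ _ _ _ _ _ _ _ vect_lift vect_descent
    vect_kernel vect_quotient vect_point.
Next Obligation. by move=> A B f U; exact: (subspace_preimage (cont_linear_homL f)). Qed.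
Next Obligation. by move=> A B f U; exact: (subspace_image (cont_linear_homL f)). Qed.
Next Obligation. by move=> A B f g; exact: cont_linear_homP. Qed.
Next Obligation. by []. Qed.
Next Obligation. by []. Qed.
Next Obligation. by []. Qed.
Next Obligation. by move=> A B f; exact: cont_linear_homB. Qed.
Next Obligation. by move=> A B f; exact: cont_linear_hom_continuous. Qed.
End Vects.

(** * A quotient to which null families do not lift *)

Lemma infinite_sequence (T : Type) (S : set T) : infinite_set S ->
  exists2 e : nat -> T, injective e & forall n, S (e n).
Proof.
elim/Ppointed: T S => T S.
  by have -> : S = set0 by [rewrite emptyE]; move=> /(_ (finite_set0 _)).
move=> /infiniteP/pcard_leP[e]; exists e => [m n emn|n].
  by apply: (@inj _ _ _ e) => //; rewrite inE.
exact: (@funS _ _ _ _ e).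
Qed.

Section FiniteSupport.
Variables (k : fieldType) (I : choiceType) (G : lmodType k).

Definition finite_support_functions : set (I -> G) :=
  [set a | finite_set [set i | a i <> 0]].

Lemma finite_support_subspace : subspace finite_support_functions.
Proof.
split=> [|c a b fa fb].
  by apply: (@sub_finite_set _ _ set0) => // i /=.
apply: (@sub_finite_set _ _ ([set i | a i <> 0] `|` [set i | b i <> 0])).
  move=> i /= nz; apply: contrapT => /not_orP[/contrapT ai /contrapT bi].
  by apply: nz; change (c *: a i + b i = 0); rewrite ai bi scaler0 addr0.
by rewrite finite_setU.
Qed.

Definition direct_sum := subgroup_type (subspace_pred finite_support_subspace).
HB.instance Definition _ := GRing.Lmodule.on direct_sum.
Implicit Types a b : direct_sum.

Lemma direct_sum_finite a : finite_set [set i | elt a i <> 0].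
Proof. by have := eltP a; rewrite inE. Qed.

Definition total (a : direct_sum) : G := \sum_(i \in [set: I]) elt a i.

Lemma total_linear : linear total.
Proof.
move=> c a b; pose S := [set i | elt a i <> 0] `|` [set i | elt b i <> 0].
have fS : finite_set S by rewrite finite_setU; split; exact: direct_sum_finite.
have totalE (d : direct_sum) : (forall i, ~ S i -> elt d i = 0) ->
    total d = \sum_(i <- fset_set S) elt d i.
  move=> d0; rewrite /total -(fsbig_widen S setT) ?fsbig_finite //.
  by move=> i [_ /d0].
have a0 i : ~ S i -> elt a i = 0 by move=> /not_orP[/contrapT].
have b0 i : ~ S i -> elt b i = 0 by move=> /not_orP[_ /contrapT].
rewrite !totalE // ?scaler_sumr -?big_split // => i nSi.
by change (c *: elt a i + elt b i = 0); rewrite a0 // b0 // scaler0 addr0.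
Qed.

Lemma total_zmod : zmod_morphism total.
Proof.
by move=> x y; rewrite addrC -scaleN1r total_linear scaleN1r addrC.
Qed.

Lemma total_in (W : set G) a : subgroup W -> (forall i, W (elt a i)) -> W (total a).
Proof.
move=> sW Wa; rewrite /total; apply: big_ind => //; first exact: sW.1.
by move=> x y; exact: subgroupD.
Qed.

Lemma single_subproof i v :
  (fun j => if j == i then v else 0) \in subspace_pred finite_support_subspace.
Proof.
rewrite inE; apply: (@sub_finite_set _ _ [set i]) => // j /=.
by case: eqP.
Qed.

Definition single i v : direct_sum := SubgroupElt (single_subproof i v).

Lemma total_single i v : total (single i v) = v.
Proof.
rewrite /total -(fsbig_widen [set i] setT) //.
  by rewrite fsbig_set1 /= eqxx.
by move=> j [_ /= /eqP/negbTE ji]; rewrite /= ji.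
Qed.
End FiniteSupport.

Section CountableBoxes.
Variables (k : fieldType) (I : choiceType) (G : lmodType k) (B : subgroup_base G).
Hypothesis uncountable_index : forall F : set I, countable F -> exists i, ~ F i.
Local Notation A := (direct_sum I G).

(** With [F] ranging over the countable sets of indices and [W] over the base of
    [G], these are the neighborhoods of zero in the direct sum. *)
Definition box (F : set I) (W : set G) : set A :=
  [set a | (forall i, F i -> elt a i = 0) /\ forall i, W (elt a i)].

Lemma box_mono F F' W W' : F `<=` F' -> W' `<=` W -> box F' W' `<=` box F W.
Proof. by move=> FF WW a [a0 aW]; split=> i; [move=> /FF/a0|exact: WW]. Qed.

Lemma box_subspace F W : subspace W -> subspace (box F W).
Proof.
move=> [W0 WL]; split=> // c a b [a0 aW] [b0 bW]; split=> i => [Fi|].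
  by change (c *: elt a i + elt b i = 0); rewrite a0 // b0 // scaler0 addr0.
by change (W (c *: elt a i + elt b i)); exact: WL.
Qed.

Lemma countableU (F F' : set I) : countable F -> countable F' -> countable (F `|` F').
Proof.
move=> cF cF'; rewrite -bigcup2E; apply: bigcup_countable => // -[|[|n]] _ //=.
Qed.

Hypothesis Bsub : forall W, base_set B W -> subspace W.

Program Definition box_base : subgroup_base A := @SubgroupBase A
  [set U | exists F W, [/\ countable F, base_set B W & U = box F W]] _ _ _.
Next Obligation.
by move=> _ [F [W [_ BW ->]]]; apply/subspace_subgroup/box_subspace/Bsub.
Qed.
Next Obligation.
move=> _ _ [F [W [cF BW ->]]] [F' [W' [cF' BW' ->]]].
have [W2 BW2 W2W] := base_setI BW BW'; exists (box (F `|` F') W2).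
  by exists (F `|` F'), W2; split=> //; exact: countableU.
move=> a aF; split; move: aF; apply: box_mono.
- by move=> i; left.
- by move=> x /W2W[].
- by move=> i; right.
- by move=> x /W2W[].
Qed.
Next Obligation.
by have [W BW] := base_nonempty B; exists (box set0 W), set0, W.
Qed.

Lemma box_base_subspace U : base_set box_base U -> subspace U.
Proof. by move=> [F [W [_ BW ->]]]; exact/box_subspace/Bsub. Qed.

Lemma box_separated (a : A) : (forall U, base_set box_base U -> U a) -> a = 0.
Proof.
have [W BW] := base_nonempty B => a0; apply: val_inj; apply: funext => i.
have [] : box [set i] W a by apply: a0; exists [set i], W; split=> //; exact: countable1.
by move=> /(_ i erefl).
Qed.

(** The limit exists coordinatewise since the coordinate [i] of a Cauchy family
    is constant inside [box [set i] W]. If its support were infinite, it would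
    contain an infinite countable set [F], on which the limit coincides with the
    finitely supported member of the family in [box F W]. *)
Lemma box_complete : base_complete box_base.
Proof.
have [W0 BW0] := base_nonempty B; move=> c cc.
have Bb F W : countable F -> base_set B W -> base_set box_base (box F W).
  by move=> cF BW; exists F, W.
(* any [W0] in the base gives the same value, by comparison inside a box around
   the countable set [F `|` [set i]] *)
pose f i := elt (c (box [set i] W0)) i.
have fE F W i : countable F -> base_set B W ->
    (F i -> elt (c (box F W)) i = f i) /\ W (elt (c (box F W)) i - f i).
  move=> cF BW; have [W' BW' W'W] := base_setI BW BW0.
  have ci : countable [set i] by exact: countable1.
  have cFi := countableU cF ci.
  have [|e1 _] := cc _ _ (Bb _ _ ci BW0) (Bb _ _ cFi BW').
    by apply: box_mono => [j|x /W'W[]]; [right|].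
  have [|e2 e3] := cc _ _ (Bb _ _ cF BW) (Bb _ _ cFi BW').
    by apply: box_mono => [j|x /W'W[]]; [left|].
  have := e1 i erefl; rewrite elt_zmod => /eqP; rewrite subr_eq0 => /eqP e.
  split=> [Fi|].
    by have := e2 i Fi; rewrite elt_zmod => /eqP; rewrite subr_eq0 /f -e => /eqP.
  by rewrite /f -e; apply: (subgroupBC (base_subgroup BW)); exact: e3.
have ff : f \in subspace_pred (finite_support_subspace I G).
  rewrite inE; apply: contrapT => /infinite_sequence[e einj nz].
  have cE : countable (range e) by apply: card_image_le.
  apply: infinite_nat; apply: sub_finite_set (finite_preimage (f := e) _
    (direct_sum_finite (c (box (range e) W0)))); last by move=> m n _ _; exact: einj.
  move=> n _ /=; have [e1 _] := fE _ _ (e n) cE BW0.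
  by rewrite e1; [exact: nz|exists n].
exists (SubgroupElt ff) => _ [F [W [cF BW ->]]].
split=> i => [Fi|]; have [e1 e2] := fE F W i cF BW.
  by change (elt (c (box F W)) i - f i = 0); rewrite e1 // subrr.
exact: e2.
Qed.

(** Every element of [W] is the sum of a family concentrated at one index
    outside [F]. *)
Lemma total_box F W : countable F -> base_set B W -> @total k I G @` box F W = W.
Proof.
move=> cF BW; apply/seteqP; split=> [_ [a [_ aW] <-]|v Wv].
  exact: total_in (base_subgroup BW) aW.
have [i nFi] := uncountable_index cF.
exists (single i v); last exact: total_single.
split=> j => [Fj|] /=; first by case: eqP => // ji; case: nFi; rewrite -ji.
by case: eqP => // _; exact: (base_subgroup BW).1.
Qed.

Local Notation AT := (lintop box_base).
Local Notation GT := (lintop B).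

Lemma total_open (subA : set (set AT)) (subG : set (set GT)) :
  (forall U, subA U -> subgroup U) -> (forall W, base_set B W -> subG W) ->
  open_surjection subA subG (@total k I G : AT -> GT).
Proof.
move=> sA Bs; split=> [v|U oU].
  by have [i _] := uncountable_index (countable0 I);
    exists (@single k I G i v); exact: total_single.
have [_ [F [W [cF BW ->]]] UW] := lintop_base_below (open_sub_nbhs sA oU).
exists W; first by split; [exact: Bs|exact: (lintop_open (B := B))].
by move=> v; rewrite -{1}(total_box cF BW) => -[a /UW]; exists a.
Qed.

Lemma total_continuous : continuous (@total k I G : AT -> GT).
Proof.
apply: (@morphism_continuous AT GT (base_set box_base) (base_set B)).
- exact: total_zmod.
- by move=> U; exact: base_subgroup.
- move=> P /lintop_base_below[U BU UP]; exists U => //; split=> //.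
  exact: lintop_open.
move=> W [BW _]; exists (box set0 W).
  have BB : base_set box_base (box set0 W) by exists set0, W.
  by split=> //; exact: lintop_open.
by move=> a [_ aW]; exact: total_in (base_subgroup BW) aW.
Qed.

(** The supports of the terms [a (e n)] lie in one countable set [F], so a term
    in [box F W] vanishes: all but finitely many of the [a (e n)] are zero. *)
Lemma no_null_lift (X : Type) (e : nat -> X) (c : formal_sums GT X)
    (a : formal_sums AT X) : injective e -> (forall n, c (e n) <> 0) ->
  (forall x, total (a x) = c x) -> False.
Proof.
move=> einj c0 ac; pose F := \bigcup_n [set i | elt (a (e n)) i <> 0].
have cF : countable F.
  by apply: bigcup_countable => // n _; exact/finite_set_countable/direct_sum_finite.
have [W BW] := base_nonempty B.
have N0 : nbhs (0 : AT) (box F W).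
  by exists (box F W) => [|y]; [exists F, W|rewrite /= subr0].
have := coefP a; rewrite inE => /(_ _ N0) fin.
apply: infinite_nat; apply: sub_finite_set (finite_preimage _ fin); last first.
  by move=> m n _ _; exact: einj.
move=> n _ /= [a0 _]; apply: (c0 n); rewrite -ac.
suff -> : a (e n) = 0 by exact: zmod_morphism0 (@total_zmod _ _ _).
apply: val_inj; apply: funext => i; apply: contrapT => nz.
by apply: (nz); apply: a0; exists n.
Qed.
End CountableBoxes.

Lemma uncountable_bool_sequences (F : set (nat -> bool)) :
  countable F -> exists i, ~ F i.
Proof.
move=> /countable_injP[f finj]; pose g n := xget (fun=> false) [set j | F j /\ f j = n].
(* Cantor diagonal: [g] enumerates [F] *)
exists (fun n => ~~ g n n) => Fi; set i := (fun n => _) in Fi.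
have gi : g (f i) = i.
  rewrite /g; case: xgetP => [j _ [Fj ji]|/(_ i)[]//].
  by apply: finj => //; rewrite inE.
by have : i (f i) = ~~ g (f i) (f i) by []; rewrite gi; case: (i _).
Qed.

Section Sequences.
Variable k : fieldType.

Definition sequences : lmodType k := nat -> k^o.

Definition vanishing_below (n : nat) : set sequences :=
  [set f | forall j, (j < n)%N -> f j = 0].

Lemma vanishing_below_subspace n : subspace (vanishing_below n).
Proof.
split=> // a f g f0 g0 j jn.
by change (a *: f j + g j = 0); rewrite f0 // g0 // scaler0 addr0.
Qed.

Lemma vanishing_below_mono m n : (m <= n)%N ->
  vanishing_below n `<=` vanishing_below m.
Proof. by move=> mn f f0 j jm; apply: f0; exact: leq_trans mn. Qed.

Program Definition sequence_base : subgroup_base sequences :=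
  @SubgroupBase sequences (range vanishing_below) _ _ _.
Next Obligation.
by move=> _ [n _ <-]; exact/subspace_subgroup/vanishing_below_subspace.
Qed.
Next Obligation.
move=> _ _ [m _ <-] [n _ <-]; exists (vanishing_below (maxn m n)).
  by exists (maxn m n).
by move=> f f0; split; apply: vanishing_below_mono f0; rewrite ?leq_maxl ?leq_maxr.
Qed.
Next Obligation. by exists (vanishing_below 0), 0. Qed.

Lemma sequence_base_subspace U : base_set sequence_base U -> subspace U.
Proof. by move=> [n _ <-]; exact: vanishing_below_subspace. Qed.

Lemma sequence_separated (f : sequences) :
  (forall U, base_set sequence_base U -> U f) -> f = 0.
Proof.
move=> f0; apply: funext => j.
have : vanishing_below j.+1 f by apply: f0; exists j.+1.
exact.
Qed.

Lemma sequence_complete : base_complete sequence_base.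
Proof.
move=> c cc; exists (fun j => c (vanishing_below j.+1) j) => _ [n _ <-] j jn.
have B m : base_set sequence_base (vanishing_below m) by exists m.
exact: (cc _ _ (B j.+1) (B n) (vanishing_below_mono jn) j (ltnSn j)).
Qed.

Section UnitVectors.
Variables (X : Type) (e : nat -> X).

Lemma unit_vectors_null :
  (fun x j => if pselect (x = e j) then 1 else 0 : k^o) \in
    @converging_family (lintop sequence_base) X.
Proof.
rewrite inE => N /lintop_base_below[_ [n _ <-] nN].
apply: (@sub_finite_set _ _ (e @` `I_n)); last exact: finite_image.
move=> x /= nNx; apply: contrapT => xe; apply: nNx; apply: nN => j jn.
by case: pselect => // xj; case: xe; exists j.
Qed.

(** At [e n] this is the [n]-th unit vector, and zero outside the range of
    [e]. *)
Definition unit_vectors := FormalSum unit_vectors_null.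

Lemma unit_vectors_neq0 n : unit_vectors (e n) <> 0.
Proof.
move=> /(congr1 (fun f => f n)) /=; case: pselect => // _ /eqP.
by rewrite oner_eq0.
Qed.
End UnitVectors.
End Sequences.

(** * The functors are not exact *)

(** Every open surjection is part of a sequence of the maximal exact
    structure. *)
Lemma exact_functor_surjective (C : linear_category) (F : additive_functor C C)
    (A B : C) (p : hom A B) :
  exact_functor (@strict_exact C) (@strict_exact C) F ->
  open_surjection (@sub C A) (@sub C B) (fn p) ->
  forall y, exists x, fn (fhom F p) x = y.
Proof.
move=> exF op; have [K [i [ei ki]]] := kernel_object p.
have ex : strict_exact (ShortSeq i p) by split.
by have [_ [sF _] _] := exF _ ex.
Qed.

Section Counterexample.
Variables (k : fieldType) (X : Type) (G : lmodType k) (B : subgroup_base G).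
Hypotheses (Bsub : forall U, base_set B U -> subspace U)
  (separated : forall x : G, (forall U, base_set B U -> U x) -> x = 0)
  (complete : base_complete B).
Variables (e : nat -> X) (c : formal_sums (lintop B) X).
Hypotheses (e_inj : injective e) (c_neq0 : forall n, c (e n) <> 0).

Local Notation I := (nat -> bool).
Local Notation sum_base := (@box_base k I G B Bsub).

Lemma formal_sums_group_not_exact :
  ~ exact_functor (@strict_exact group_category) (@strict_exact group_category)
      (formal_sums_group_functor X).
Proof.
have scV := lintop_sc (sub := @subgroup (lintop B)) (fun _ => id)
  (@base_subgroup _ B) separated complete.
have scA := lintop_sc (sub := @subgroup (lintop sum_base)) (fun _ => id)
  (@base_subgroup _ sum_base) (@box_separated k I G B Bsub) (@box_complete k I G B Bsub).
pose p : cont_hom (TopscGroup scA) (TopscGroup scV) :=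
  mk_cont_hom (@total_zmod k I G : zmod_morphism (_ : lintop sum_base -> lintop B))
    (@total_continuous k I G B Bsub).
move=> exF.
have [|a ac] := @exact_functor_surjective group_category (formal_sums_group_functor X)
    (TopscGroup scA) (TopscGroup scV) p exF _ c.
  apply: (total_open uncountable_bool_sequences) => // U; exact: base_subgroup.
apply: (no_null_lift e_inj c_neq0 (a := a)) => x.
exact: (congr1 (fun f : formal_sums (lintop B) X => f x) ac).
Qed.

Lemma formal_sums_vect_not_exact :
  ~ exact_functor (@strict_exact (vect_category k)) (@strict_exact (vect_category k))
      (formal_sums_vect_functor k X).
Proof.
have scV := lintop_vect_sc Bsub separated complete.
have Asub := @box_base_subspace k I G B Bsub.
have scA := lintop_vect_sc Asub (@box_separated k I G B Bsub)
  (@box_complete k I G B Bsub).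
pose p : cont_linear_hom (TopscVect scA) (TopscVect scV) :=
  mk_cont_linear (@total_linear k I G : linear (_ : lintop_vect Asub -> lintop_vect Bsub))
    (@total_continuous k I G B Bsub).
move=> exF.
have [|a ac] := @exact_functor_surjective (vect_category k) (formal_sums_vect_functor k X)
    (TopscVect scA) (TopscVect scV) p exF _ c.
  apply: (total_open uncountable_bool_sequences) => //.
  exact: (lintop_subspace_subgroup (Bsub := Asub)).
apply: (no_null_lift e_inj c_neq0 (a := a)) => x.
exact: (congr1 (fun f : formal_sums (lintop B) X => f x) ac).
Qed.
End Counterexample.

Theorem corollary11p4 (k : fieldType) :
  (forall X : Type, infinite_set [set: X] ->
     exists E : short_seq Topsc_group -> Prop,
       maximal_exact_structure E /\
       ~ exact_functor E E (formal_sums_group_functor X)) /\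
  (forall X : Type, infinite_set [set: X] ->
     exists E : short_seq (Topsc_vect k) -> Prop,
       maximal_exact_structure E /\
       ~ exact_functor E E (formal_sums_vect_functor k X)).
Proof.
split=> X /infinite_sequence[e e_inj _].
  exists (@strict_exact group_category); split.
    exact: (@strict_exact_maximal group_category).
  exact: (formal_sums_group_not_exact (@sequence_base_subspace k)
    (@sequence_separated k) (@sequence_complete k) e_inj (unit_vectors_neq0 (e := e))).
exists (@strict_exact (vect_category k)); split.
  exact: (@strict_exact_maximal (vect_category k)).
exact: (formal_sums_vect_not_exact (@sequence_base_subspace k)
    (@sequence_separated k) (@sequence_complete k) e_inj (unit_vectors_neq0 (e := e))).
Qed.
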